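(* Let $k\ge 1$ and $n>k$ be integers, and let $G=\mathrm{Car}^{(k)}_{n+1}$ be the $k$-caracol graph. Then $$\operatorname{vol}\mathcal F_{G}(1,0,\ldots,0,-1)=\mathrm{Cat}\big(n-k,\;k(n-k)-1\big).$$
   Context: The $k$-caracol graph $\mathrm{Car}^{(k)}_{n+1}$ is the directed graph (no multiple edges) with vertex set $\{1,\ldots,n+1\}$ and edge set $\{(i,i+1),(i,k+1),(i,k+2),\ldots,(i,n): 1\le i\le k\}\cup\{(i,i+1),(i,n+1): k+1\le i\le n\}$, each edge $(i,j)$ directed from $i$ to $j$. For a directed graph $G$ on $\{1,\ldots,n+1\}$ with edge (multi)set $E$ and a vector $\mathbf a=(a_1,\ldots,a_n,-\sum_i a_i)$ with $a_i\ge 0$, the flow polytope $\mathcal F_G(\mathbf a)$ is the set of $(f_e)_{e\in E}\in\mathbb R_{\ge0}^{E}$ such that for each $j=1,\ldots,n$, the total flow on edges leaving $j$ minus the total flow on edges entering $j$ equals $a_j$. The normalized volume $\operatorname{vol}$ of a $d$-dimensional polytope is $d!$ times its $d$-dimensional relative volume (normalized with respect to the integer lattice in the linear space parallel to its affine hull). For positive integers $a$ and nonnegative integers $b$, $\mathrm{Cat}(a,b)=\frac{1}{a+b}\binom{a+b}{a}$ (the rational Catalan number). *)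

(* Defs.v *)
From HB Require Import structures.
From mathcomp Require Import all_boot all_order all_algebra.
From mathcomp Require Import all_classical all_reals all_analysis.
Set Implicit Arguments.
Unset Strict Implicit.
Unset Printing Implicit Defensive.
Import Order.TTheory GRing.Theory Num.Theory.
Local Open Scope classical_set_scope.
Local Open Scope ring_scope.

(* A directed multigraph on the vertices 1, ..., n+1 is the sequence of its
   edges (source, target); a flow is a vector indexed by the positions in it. *)
Definition digraph := seq (nat * nat).

Definition edge_src (G : digraph) (e : 'I_(size G)) : nat :=
  (tnth (in_tuple G) e).1.
Definition edge_tgt (G : digraph) (e : 'I_(size G)) : nat :=
  (tnth (in_tuple G) e).2.

(* Conservation is imposed at the vertices 1, ..., n only: the equation at n+1
   follows from the others, and [a n.+1] is not used. *)
Definition flow_polytope (R : realType) (n : nat) (G : digraph) (a : nat -> R) :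
    set 'rV[R]_(size G) :=
  [set f | (forall e, 0 <= f 0 e) /\
           (forall j : nat, (1 <= j <= n)%N ->
              \sum_(e | edge_src e == j) f 0 e
              - \sum_(e | edge_tgt e == j) f 0 e = a j)].
Arguments flow_polytope {R} n G a.

Definition unit_netflow (R : realType) (n : nat) (j : nat) : R :=
  if j == 1%N then 1 else if j == n.+1 then -1 else 0.

Definition caracol_edge (k n : nat) (e : nat * nat) : bool :=
  let: (i, j) := e in
  ((1 <= i <= k)%N && ((j == i.+1) || (k.+1 <= j <= n)%N)) ||
  ((k.+1 <= i <= n)%N && ((j == i.+1) || (j == n.+1))).

Definition caracol (k n : nat) : digraph :=
  [seq e <- [seq (i, j) | i <- iota 1 n.+1, j <- iota 1 n.+1]
     | caracol_edge k n e].

Definition affine_hull (R : realType) (m : nat) (P : set 'rV[R]_m) :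
    set 'rV[R]_m :=
  [set x | exists (s : nat) (t : 'I_s -> R) (y : 'I_s -> 'rV[R]_m),
      [/\ forall i, P (y i), \sum_i t i = 1 & x = \sum_i t i *: y i]].

Definition direction (R : realType) (m : nat) (P : set 'rV[R]_m) :
    set 'rV[R]_m :=
  [set v | exists x y, [/\ affine_hull P x, affine_hull P y & v = x - y]].

(* The rows of [B] form a Z-basis of the lattice of integer points of
   [direction P], and this lattice has full rank in [direction P]; in particular
   [d] is the dimension of [P]. *)
Definition lattice_basis (R : realType) (m d : nat) (P : set 'rV[R]_m)
    (B : 'M[int]_(d, m)) : Prop :=
  let BR : 'M[R]_(d, m) := map_mx intr B in
  [/\ row_free BR,
      forall v : 'rV[R]_m, direction P v <-> (v <= BR)%MS
    & forall z : 'rV[int]_m, direction P (map_mx intr z) ->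
        exists c : 'rV[int]_d, z = c *m B].

(* The d-fold product of the Lebesgue measure on the line, in the form of the
   library's binary product: (m1 \x m2) A is the integral of m2 (xsection A x)
   against m1.  It is Lebesgue measure on the Borel sets of R^d, and the unit
   mass of the one-point space when d = 0. *)
Fixpoint lebesgue_volume (R : realType) (d : nat) :
    set (d.-tuple R) -> \bar R :=
  match d with
  | 0 => fun S => dirac [tuple] S
  | d'.+1 => fun S =>
      (\int[@lebesgue_measure R]_x
         lebesgue_volume [set v : d'.-tuple R | S [tuple of x :: v]])%E
  end.

Definition lattice_chart (R : realType) (m d : nat) (p : 'rV[R]_m)
    (B : 'M[int]_(d, m)) (c : d.-tuple R) : 'rV[R]_m :=
  p + (\row_i tnth c i) *m map_mx intr B.

(* The value depends neither on the lattice basis [B] nor on the origin [p]: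
   two charts differ by a translation and an element of GL_d(Z).  The default
   value 0 is taken when [P] is empty or its direction is not rational. *)
Definition normalized_volume (R : realType) (m : nat) (P : set 'rV[R]_m) :
    \bar R :=
  xget 0%E [set v | exists (d : nat) (B : 'M[int]_(d, m)) (p : 'rV[R]_m),
    [/\ lattice_basis P B, affine_hull P p
      & v = ((d`!)%:R%:E * lebesgue_volume (lattice_chart p B @^-1` P))%E]].

Definition rational_catalan (R : realType) (a b : nat) : R :=
  (a + b)%N%:R^-1 * 'C((a + b)%N, a)%:R.

(* Main.v *)
Require Import Defs.
From HB Require Import structures.
From mathcomp Require Import all_boot all_order all_algebra.
From mathcomp Require Import all_classical all_reals all_analysis.
From mathcomp Require Import unstable measurable_realfun.
From mathcomp Require Import zify ring lra.
Import Order.TTheory GRing.Theory Num.Theory.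
Import numFieldNormedType.Exports.
Local Open Scope classical_set_scope.
Local Open Scope ring_scope.

Set Implicit Arguments.
Unset Strict Implicit.
Unset Printing Implicit Defensive.

(* Put m = n - k.  A flow is determined by the flows y on the k m edges from
   {1, ..., k} to {k + 1, ..., n} and the flows w on the m edges into n + 1: y and
   w range over two standard simplices, and the only further condition is that
   the partial sums of w are dominated by those of the column sums of y (these
   differences are the flows on the path k + 1 -> ... -> n).  Rotating the
   columns of y and the entries of w cyclically preserves volume, and by the
   cycle lemma the m rotates of the polytope tile the product of the two
   simplices up to a null set.  Hence its Euclidean volume is
   1 / m * 1 / (k m - 1)! * 1 / (m - 1)!, in dimension k m + m - 2.

   That this volume does not depend on the lattice basis comes from the linear
   change of variables formula for the iterated integral. *)

(** The differences of partial sums form a closed walk, starting and ending at 0 because both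
    families have total 1. Rotating by [r] starts the walk at its [r]-th point and subtracts the
    value there, so the rotated walk is nonnegative exactly when that value is a minimum. Almost
    every walk has a single minimum, whence the factor 1 / m. The flows on 1 -> ... -> k are sums of
    entries of y, so they are nonnegative as soon as y is. Two features of the definitions shape the
    analytic half. The volume is an iterated integral of arbitrary sets, and becomes additive and
    open to Fubini only once it is identified, on measurable sets, with a sigma-finite measure. The
    normalized volume is a choice among all lattice charts, so an explicit chart can be used only
    after comparison with an unknown one. Multiplying by the factorial of the dimension gives (k m +
    m - 2)! / ((k m - 1)! m!), which is the rational Catalan number. *)

(** * Affine change of variable on the line *)

Section LebesgueAffine.
Context {R : realType}.
Local Notation lambda := (@lebesgue_measure R).

Lemma measurable_affine1 (a t : R) :
  measurable_fun [set: R] (fun x : R => a * x + t : measurableTypeR R).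
Proof.
by apply: measurable_funD => //; apply: measurable_funM.
Qed.

(** The scaled pushforward is a measure with the right value on every interval []x, y]], and
    Lebesgue measure is the only such measure. A negative slope exchanges the open and the closed
    end, which does not affect the length. *)
Lemma lebesgue_measure_affine (a t : R) (A : set R) : a != 0 -> measurable A ->
  lambda A = (`|a|%:E * lambda ((fun x => a * x + t)%R @^-1` A))%E.
Proof.
move=> a0 mA.
pose f := fun x : R => (a * x + t)%R : measurableTypeR R.
pose nu := mscale (NngNum (normr_ge0 a)) (pushforward lambda f).
have mf : measurable_fun setT f by exact: measurable_affine1.
suff -> : lambda A = nu mf A by [].
apply: (lebesgue_measure_unique (mu := nu mf)) mA => _ [[x y] _ <-] /=.
rewrite /nu /mscale /= /pushforward.
case: (ltgtP a 0) a0 => // a0 _.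
- have -> : f @^-1` [set` `]x, y]] = [set` `[(y - t) / a, (x - t) / a[].
    apply/seteqP; split => z /=; rewrite !in_itv/= /f.
      by move=> /andP[h1 h2]; rewrite ler_ndivrMr// ltr_ndivlMr//; apply/andP; split; lra.
    by rewrite ler_ndivrMr// ltr_ndivlMr// => /andP[h1 h2]; apply/andP; split; lra.
  rewrite !lebesgue_measure_itv/= !lte_fin (ltr_nM2r (x := a^-1)) ?invr_lt0//.
  rewrite ltrD2r; case: ifPn => _; last by rewrite mule0.
  by rewrite -!EFinB -EFinM ltr0_norm//; congr (_%:E); field; rewrite lt_eqF.
- have -> : f @^-1` [set` `]x, y]] = [set` `](x - t) / a, (y - t) / a]].
    apply/seteqP; split => z /=; rewrite !in_itv/= /f.
      by move=> /andP[h1 h2]; rewrite ler_pdivlMr// ltr_pdivrMr//; apply/andP; split; lra.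
    by rewrite ler_pdivlMr// ltr_pdivrMr// => /andP[h1 h2]; apply/andP; split; lra.
  rewrite !lebesgue_measure_itv/= !lte_fin (ltr_pM2r (x := a^-1)) ?invr_gt0//.
  rewrite ltrD2r; case: ifPn => _; last by rewrite mule0.
  by rewrite -!EFinB -EFinM gtr0_norm//; congr (_%:E); field; rewrite gt_eqF.
Qed.

Lemma ge0_integral_affine (a t : R) (f : R -> \bar R) : a != 0 ->
  measurable_fun [set: R] f -> (forall x, 0 <= f x)%E ->
  (\int[lambda]_x f (a * x + t)%R = (`|a|^-1)%:E * \int[lambda]_x f x)%E.
Proof.
move=> a0 mf f0.
pose g : measurableTypeR R -> measurableTypeR R := fun x => (a * x + t)%R.
have mg : measurable_fun setT g by exact: measurable_affine1.
have E := @ge0_integral_pushforward _ _ _ _ R g mg lambda setT f measurableT mf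
  (fun y _ => f0 y).
rewrite preimage_setT in E.
rewrite -[LHS]E.
pose nu := mscale (NngNum (normr_ge0 a)) (pushforward lambda g).
have -> : (\int[lambda]_x f x = \int[nu mg]_x f x)%E.
  apply: (@eq_measure_integral _ _ _ setT (nu mg) lambda) => A mA _ /=.
  exact: lebesgue_measure_affine.
rewrite [in RHS](@ge0_integral_mscale _ _ R _ setT measurableT)//.
by rewrite muleA -EFinM mulVf ?normr_eq0// mul1e.
Qed.

End LebesgueAffine.

(** * The iterated integral as a sigma-finite measure *)

Section ConsMeasure.
Context {R : realType}.
Local Notation T := (measurableTypeR R).
Local Notation lambda := (@lebesgue_measure R).
Variables (d : nat) (mu : {sigma_finite_measure set (d.-tuple T) -> \bar R}).

Definition tuple_cons (z : T * d.-tuple T) : d.+1.-tuple T :=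
  [tuple of z.1 :: z.2].

Lemma measurable_tuple_cons : measurable_fun setT tuple_cons.
Proof. exact: (measurable_cons measurable_fst measurable_snd). Qed.

(** Product measure transported from pairs to tuples; it is the inductive step in showing that the
    iterated integral is a measure. *)
Definition cons_measure := pushforward (lambda \x mu)%E tuple_cons.

Let cons_measure0 : cons_measure set0 = 0%E.
Proof. by rewrite /cons_measure /pushforward preimage_set0 measure0. Qed.

Let cons_measure_ge0 A : (0 <= cons_measure A)%E.
Proof. by rewrite /cons_measure /pushforward measure_ge0. Qed.

Let cons_measure_sigma_additive : semi_sigma_additive cons_measure.
Proof.
have mc := measurable_tuple_cons.
have m A : measurable A -> measurable (tuple_cons @^-1` A).
  by move=> mA; rewrite -[X in measurable X]setTI; exact: mc.
move=> F mF tF mUF; rewrite /cons_measure /pushforward preimage_bigcup.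
apply: measure_semi_sigma_additive.
- by move=> n; exact: m.
- apply/trivIsetP => /= i j _ _ ij; rewrite -preimage_setI.
  by move/trivIsetP : tF => /(_ _ _ _ _ ij) ->//; rewrite preimage_set0.
- by rewrite -preimage_bigcup; exact: m.
Qed.

HB.instance Definition _ := isMeasure.Build _ _ _ cons_measure
  cons_measure0 cons_measure_ge0 cons_measure_sigma_additive.

Definition tuple_uncons (v : d.+1.-tuple T) : T * d.-tuple T :=
  (thead v, [tuple of behead v]).

Lemma tuple_consK : cancel tuple_cons tuple_uncons.
Proof.
by case=> x v; rewrite /tuple_uncons /tuple_cons/= theadE; congr pair; exact/val_inj.
Qed.

Lemma measurable_tuple_uncons : measurable_fun setT tuple_uncons.
Proof.
apply: measurable_fun_pair; last exact: measurable_behead.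
exact: measurable_tnth.
Qed.

Let cons_measure_sigma_finite : sigma_finite setT cons_measure.
Proof.
have /sigma_finiteP[F [TF ndF Foo]] := sigma_finiteT lambda.
have /sigma_finiteP[G [TG ndG Goo]] := sigma_finiteT mu.
exists (fun n => tuple_uncons @^-1` (F n `*` G n)).
  rewrite -preimage_bigcup; apply/esym/seteqP; split => // v _ /=.
  have [i _ Fi] : (\bigcup_i F i) (tuple_uncons v).1 by rewrite -TF.
  have [j _ Gj] : (\bigcup_i G i) (tuple_uncons v).2 by rewrite -TG.
  (* Both exhausting sequences are nondecreasing, so one index serves both factors. *)
  exists (maxn i j) => //; split.
    by move: Fi; exact/subsetPset/ndF/leq_maxl.
  by move: Gj; exact/subsetPset/ndG/leq_maxr.
move=> n; have [? ?] := Foo n; have [? ?] := Goo n; split.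
  rewrite -[X in measurable X]setTI; apply: measurable_tuple_uncons => //.
  exact: measurableX.
rewrite /cons_measure /pushforward -comp_preimage.
have -> : tuple_uncons \o tuple_cons = id.
  by apply/funext => z /=; exact: tuple_consK.
by rewrite preimage_id product_measure1E// lte_mul_pinfty// ge0_fin_numE.
Qed.

HB.instance Definition _ := Measure_isSigmaFinite.Build _ _ _ cons_measure
  cons_measure_sigma_finite.

End ConsMeasure.

Section LebesgueVolume.
Context {R : realType}.
Local Notation T := (measurableTypeR R).
Local Notation lambda := (@lebesgue_measure R).
Local Notation vol := (@lebesgue_volume R _).

(** Gives access to measure theory for a function defined by recursion on all sets. Sigma-finiteness
    is carried along because the product with one more line, and Fubini, require it. *)
Lemma lebesgue_volume_is_measure d :
  exists mu : {sigma_finite_measure set (d.-tuple T) -> \bar R},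
    forall S : set (d.-tuple T), measurable S -> vol S = mu S.
Proof.
elim: d => [|d [mu muE]].
  by exists (dirac ([tuple] : 0.-tuple T)).
exists (cons_measure mu) => S mS.
rewrite /= /cons_measure /pushforward /product_measure1.
apply: eq_integral => x _ /=.
have mC : measurable (@tuple_cons R d @^-1` S).
  by rewrite -[X in measurable X]setTI; exact: measurable_tuple_cons.
rewrite -muE; last exact: measurable_xsection.
congr (vol _); apply/seteqP; split => v /=; rewrite /xsection /= inE //.
Qed.

End LebesgueVolume.

Section VolumeTheory.
Context {R : realType}.
Local Notation T := (measurableTypeR R).
Local Notation lambda := (@lebesgue_measure R).
Local Notation vol := (@lebesgue_volume R _).

Lemma measurable_tuple_cons_preimage d (S : set (d.+1.-tuple T)) :
  measurable S -> measurable (@tuple_cons R d @^-1` S).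
Proof.
by move=> mS; rewrite -[X in measurable X]setTI; exact: measurable_tuple_cons.
Qed.

Lemma tuple_section_xsection d (S : set (d.+1.-tuple T)) (x : T) :
  [set v : d.-tuple T | S [tuple of x :: v]] =
  xsection (@tuple_cons R d @^-1` S) x.
Proof. by apply/seteqP; split => v /=; rewrite /xsection /= inE. Qed.

Lemma measurable_tuple_section d (S : set (d.+1.-tuple T)) (x : T) :
  measurable S -> measurable [set v : d.-tuple T | S [tuple of x :: v]].
Proof.
move=> mS; rewrite tuple_section_xsection.
by apply: measurable_xsection; exact: measurable_tuple_cons_preimage.
Qed.

Lemma measurable_fun_section_volume d (S : set (d.+1.-tuple T)) :
  measurable S ->
  measurable_fun setT (fun x : T => vol [set v : d.-tuple T | S [tuple of x :: v]]).
Proof.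
move=> mS; have [mu muE] := @lebesgue_volume_is_measure R d.
rewrite (_ : (fun x => _) = mu \o xsection (@tuple_cons R d @^-1` S)).
  by apply: measurable_fun_xsection; exact: measurable_tuple_cons_preimage.
apply/funext => x /=; rewrite muE; last exact: measurable_tuple_section.
by rewrite tuple_section_xsection.
Qed.

Lemma lebesgue_volume_ge0 d (S : set (d.-tuple T)) : (0 <= vol S)%E.
Proof.
elim: d S => [|d IH] S /=; first exact: measure_ge0.
by apply: integral_ge0 => x _; exact: IH.
Qed.

(** The definition integrates the first coordinate outermost; here it comes innermost, as needed to
    move it by an amount depending on the others. *)
Lemma lebesgue_volume_fubini d (S : set (d.+1.-tuple T))
    (mu : {sigma_finite_measure set (d.-tuple T) -> \bar R}) :
    (forall S : set (d.-tuple T), measurable S -> vol S = mu S) ->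
    measurable S ->
  vol S = (\int[mu]_v lambda [set x : T | S [tuple of x :: v]])%E.
Proof.
move=> muE mS.
have mC := measurable_tuple_cons_preimage mS.
transitivity (\int[lambda]_x (mu \o xsection (@tuple_cons R d @^-1` S)) x)%E.
  apply: eq_integral => x _ /=; rewrite -/lebesgue_volume muE; last exact: measurable_tuple_section.
  by rewrite tuple_section_xsection.
have := @indic_fubini_tonelli _ _ _ _ R lambda mu _ mC.
rewrite indic_fubini_tonelli_FE// indic_fubini_tonelli_GE// => ->.
apply: eq_integral => v _ /=; congr (lambda _).
by apply/seteqP; split => x /=; rewrite /ysection /= inE.
Qed.

(** Once the other coordinates are fixed, the shear is a translation of the line. *)
Lemma lebesgue_volume_shear d (S : set (d.+1.-tuple T)) (l : d.-tuple T -> R) :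
    measurable_fun setT (l : d.-tuple T -> T) -> measurable S ->
  vol [set c : d.+1.-tuple T |
        S [tuple of (thead c + l [tuple of behead c])%R :: behead c]] = vol S.
Proof.
move=> ml mS; have [mu muE] := @lebesgue_volume_is_measure R d.
pose f (c : d.+1.-tuple T) : d.+1.-tuple T :=
  [tuple of (thead c + l [tuple of behead c])%R :: [tuple of behead c]].
have mf : measurable_fun setT f.
  apply: measurable_cons; last exact: measurable_behead.
  apply: measurable_funD; first exact: measurable_tnth.
  apply: measurableT_comp => //; exact: measurable_behead.
have -> : [set c : d.+1.-tuple T |
    S [tuple of (thead c + l [tuple of behead c])%R :: behead c]] = f @^-1` S.
  apply/seteqP; split => c /=; congr (S _); exact/val_inj.
have mfS : measurable (f @^-1` S) by rewrite -[X in measurable X]setTI; exact: mf.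
rewrite (lebesgue_volume_fubini muE mS) (lebesgue_volume_fubini muE mfS).
apply: eq_integral => v _.
have ms : measurable [set x : T | S [tuple of x :: v]].
  have := measurable_ysection v (measurable_tuple_cons_preimage mS).
  by congr measurable; apply/seteqP; split => x /=; rewrite /ysection /= inE.
rewrite (@lebesgue_measure_affine R 1 (l v) _ (oner_neq0 _) ms) normr1 mul1e.
congr (lambda _); apply/seteqP; split => x /=; rewrite mul1r /f theadE.
  by congr (S _); apply/val_inj => /=; congr (_ + l _ :: _); exact/val_inj.
by congr (S _); apply/val_inj => /=; congr (_ + l _ :: _); exact/val_inj.
Qed.

End VolumeTheory.

(** * Linear change of variables in dimension d *)

Section LinearChange.
Context {R : realType}.
Local Notation T := (measurableTypeR R).
Local Notation lambda := (@lebesgue_measure R).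
Local Notation vol := (@lebesgue_volume R _).

Definition row_of_tuple d (c : d.-tuple R) : 'rV[R]_d := \row_i tnth c i.
Definition tuple_of_row d (u : 'rV[R]_d) : d.-tuple R := [tuple u 0 i | i < d].

Lemma tuple_of_rowK d : cancel (@tuple_of_row d) (@row_of_tuple d).
Proof. by move=> u; apply/rowP => i; rewrite mxE tnth_mktuple. Qed.

Lemma row_of_tupleK d : cancel (@row_of_tuple d) (@tuple_of_row d).
Proof. by move=> c; apply/eq_from_tnth => i; rewrite tnth_mktuple mxE. Qed.

Lemma row_of_tuple_cons d (x : R) (v : d.-tuple R) :
  row_of_tuple [tuple of x :: v] = row_mx x%:M (row_of_tuple v) :> 'rV_(1 + d).
Proof.
apply/rowP => i; rewrite !mxE; case: splitP => j ij.
  rewrite !mxE ord1 eqxx mulr1n.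
  by have -> : i = ord0 by apply/val_inj; rewrite /= ij ord1.
rewrite !mxE; have -> : i = lift ord0 j by apply/val_inj.
by rewrite tnthS.
Qed.

Lemma tuple_of_row_cons d (x : R) (u : 'rV[R]_d) :
  tuple_of_row (row_mx x%:M u : 'rV_(1 + d)) = [tuple of x :: tuple_of_row u].
Proof.
by apply: (can_inj (@row_of_tupleK _)); rewrite row_of_tuple_cons !tuple_of_rowK.
Qed.

Definition affine_map d (A : 'M[R]_d) (t : 'rV[R]_d) (c : d.-tuple R) : d.-tuple R :=
  tuple_of_row (row_of_tuple c *m A + t).

Lemma affine_map_comp d (A B : 'M[R]_d) t u c :
  affine_map B u (affine_map A t c) = affine_map (A *m B) (t *m B + u) c.
Proof. by rewrite /affine_map tuple_of_rowK mulmxDl -addrA mulmxA. Qed.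

Lemma measurable_sum_fun d (U : measurableType d) (I : Type) (r : seq I)
    (f : I -> U -> T) : (forall i, measurable_fun setT (f i)) ->
  measurable_fun setT (fun x => \sum_(i <- r) f i x : T).
Proof.
move=> mf; elim: r => [|i r IH].
  by under eq_fun do rewrite big_nil; exact: measurable_cst.
under eq_fun do rewrite big_cons.
exact: (measurable_funD (mf i) IH).
Qed.

Lemma measurable_affine_map d (A : 'M[R]_d) t :
  measurable_fun setT (affine_map A t : d.-tuple T -> d.-tuple T).
Proof.
apply/measurable_fun_tnthP => i.
rewrite (_ : _ \o _ = fun c : d.-tuple T => (\sum_j tnth c j * A j i) + t 0 i); last first.
  apply/funext => c /=; rewrite tnth_mktuple !mxE; congr (_ + _).
  by apply: eq_bigr => j _; rewrite mxE.
apply: measurable_funD; last exact: measurable_cst.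
apply: measurable_sum_fun => j; apply: measurable_funM; last exact: measurable_cst.
exact: measurable_tnth.
Qed.

Lemma measurable_affine_preimage d (A : 'M[R]_d) t (S : set (d.-tuple T)) :
  measurable S -> measurable (affine_map A t @^-1` S : set (d.-tuple T)).
Proof.
move=> mS; rewrite -[X in measurable X]setTI.
exact: (@measurable_affine_map d A t).
Qed.

(** Quantifying over the translation [t] is what makes the induction on [d] work: for a fixed first
    coordinate, the off-diagonal row of an upper block matrix acts on the remaining coordinates as a
    translation. *)
Let scales d (A : 'M[R]_d) := forall t (S : set (d.-tuple T)), measurable S ->
  vol (affine_map A t @^-1` S) = ((`|\det A|^-1)%:E * vol S)%E.

Let scales_mul d (A B : 'M[R]_d) : scales A -> scales B -> scales (A *m B).
Proof.
move=> sA sB t S mS.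
rewrite (_ : _ @^-1` S = affine_map A 0 @^-1` (affine_map B t @^-1` S)).
  rewrite sA; last exact: measurable_affine_preimage.
  by rewrite sB// muleA -EFinM det_mulmx normrM invfM.
by apply/seteqP; split => c /=; rewrite affine_map_comp mul0mx add0r.
Qed.

Let scales_ublock d (a : R) (r : 'rV[R]_d) (A : 'M[R]_d) : a != 0 ->
  scales A -> scales (block_mx a%:M r 0 A : 'M[R]_(1 + d)).
Proof.
move=> a0 sA t S mS.
have E x (v : d.-tuple T) : affine_map (block_mx a%:M r 0 A : 'M[R]_(1 + d)) t [tuple of x :: v] =
    [tuple of (a * x + t 0 0)%R :: affine_map A (x *: r + rsubmx (t : 'rV_(1 + d))) v].
  rewrite /affine_map row_of_tuple_cons -tuple_of_row_cons mul_row_block mulmx0 addr0.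
  congr tuple_of_row; rewrite -{1}[t](@hsubmxK _ _ 1) add_row_mx; congr row_mx.
    rewrite -scalar_mxM [lsubmx _]mx11_scalar mxE -raddfD /= mulrC.
    by congr (_ + t 0 _)%:M; exact/val_inj.
  by rewrite mul_scalar_mx [in RHS]addrCA addrA.
transitivity (\int[lambda]_x ((`|\det A|^-1)%:E *
   vol [set v : d.-tuple T | S [tuple of (a * x + t 0 0)%R :: v]]))%E.
  apply: eq_integral => x _ /=; rewrite -/lebesgue_volume.
  rewrite -(sA (x *: r + rsubmx (t : 'rV_(1 + d)))); last exact: measurable_tuple_section.
  by congr (vol _); apply/seteqP; split => v /=; rewrite E.
rewrite det_ublock det_scalar1 normrM invfM EFinM.
have mV := measurable_fun_section_volume mS.
have V0 x : (0 <= vol [set v : d.-tuple T | S [tuple of x :: v]])%E.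
  exact: lebesgue_volume_ge0.
rewrite ge0_integralZl//=; last first.
- have ma : measurable_fun setT (fun x : T => (a * x + t 0 0)%R : T).
    exact: measurable_affine1.
  exact: (measurableT_comp mV ma).
rewrite (@ge0_integral_affine R a (t 0 0) _ a0 mV V0) muleA (muleC _ (`|a|^-1)%:E).
by [].
Qed.

Let scales1 d : scales (1%:M : 'M[R]_d).
Proof.
elim: d => [|d IH].
  move=> t S mS; rewrite det1 normr1 invr1 mul1e; congr (vol _).
  by apply/seteqP; split => c /=; rewrite (tuple0 c) (tuple0 (affine_map _ _ _)).
by rewrite -[d.+1]/(1 + d)%N scalar_mx_block; apply: scales_ublock => //; exact: oner_neq0.
Qed.

Let scales_lblock d (l : 'cV[R]_d) :
  scales (block_mx 1%:M 0 l 1%:M : 'M[R]_(1 + d)).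
Proof.
set L := block_mx _ _ _ _; move=> t S mS.
pose f (v : d.-tuple T) : T := (row_of_tuple v *m l) 0 0.
have mf : measurable_fun setT f.
  rewrite (_ : f = fun c : d.-tuple T => (\sum_j tnth c j * l j 0)); last first.
    by apply/funext => c; rewrite /f mxE; apply: eq_bigr => j _; rewrite mxE.
  apply: measurable_sum_fun => j; apply: measurable_funM; last exact: measurable_cst.
  exact: measurable_tnth.
have mS1 : measurable (affine_map (1%:M : 'M[R]_(1 + d)) t @^-1` S : set ((1 + d).-tuple T)).
  exact: measurable_affine_preimage.
have LE c : affine_map L t c =
    affine_map 1%:M t [tuple of (thead c + f [tuple of behead c])%R :: behead c].
  rewrite [in LHS](tuple_eta c) /affine_map.
  rewrite (_ : [tuple of _ + _ :: _] =
     [tuple of thead c + f [tuple of behead c] :: [tuple of behead c]]); last exact/val_inj.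
  rewrite !row_of_tuple_cons; congr (tuple_of_row (_ + _)).
  rewrite mulmx1 mul_row_block !mulmx1 mulmx0 add0r; congr row_mx.
  by rewrite /f raddfD /= -mx11_scalar.
have E : affine_map L t @^-1` S = [set c : d.+1.-tuple T |
    (affine_map (1%:M : 'M[R]_(1 + d)) t @^-1` S)
      [tuple of (thead c + f [tuple of behead c])%R :: behead c]].
  by apply/seteqP; split => c /=; rewrite LE.
rewrite E (lebesgue_volume_shear mf mS1) (@scales1 (1 + d))//.
by rewrite det_lblock !det1 mulr1.
Qed.

(** Block LU factorization; the induction hypothesis is applied to the Schur complement of the
    pivot, invertible because the whole matrix is. *)
Let scales_pivot d (a : R) (b : 'rV[R]_d) (c : 'cV[R]_d) (D : 'M[R]_d) :
    (forall A : 'M[R]_d, A \in unitmx -> scales A) -> a != 0 ->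
    block_mx a%:M b c D \in unitmx ->
  scales (block_mx a%:M b c D : 'M[R]_(1 + d)).
Proof.
move=> IH a0 uA.
have E : block_mx a%:M b c D =
    block_mx 1%:M 0 (a^-1 *: c) 1%:M *m block_mx a%:M b 0 (D - a^-1 *: (c *m b)).
  rewrite mulmx_block !mul1mx !mul0mx !addr0 -scalemxAl mul_mx_scalar.
  by rewrite scalerA mulVf// scale1r -scalemxAl addrC subrK.
rewrite E; apply: scales_mul; first exact: scales_lblock.
apply: scales_ublock => //; apply: IH.
move: uA; rewrite E unitmx_mul => /andP[_].
by rewrite unitmxE det_ublock det_scalar1 unitrM => /andP[].
Qed.

(* Gaussian elimination: a zero pivot is made nonzero by a shear, so that only
   block triangular factors with respect to the first coordinate are needed. *)
Lemma lebesgue_volume_affine d (A : 'M[R]_d) t (S : set (d.-tuple T)) :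
    A \in unitmx -> measurable S ->
  vol (affine_map A t @^-1` S) = ((`|\det A|^-1)%:E * vol S)%E.
Proof.
move=> uA mS; move: uA t S mS; rewrite -/(scales A).
elim: d A => [|d IH] A uA.
  have -> : A = 1%:M by rewrite [LHS]flatmx0 [RHS]flatmx0.
  exact: scales1.
suff H (B : 'M[R]_(1 + d)) : B \in unitmx -> scales B by exact: (H A uA).
move: B => {}A {}uA.
rewrite -[A](@submxK _ 1 d 1 d) [ulsubmx _]mx11_scalar.
rewrite -[A](@submxK _ 1 d 1 d) [ulsubmx _]mx11_scalar in uA.
move: (ulsubmx _ _ _) (ursubmx _) (dlsubmx _) (drsubmx _) uA => a b c D uA.
have [a0|a0] := eqVneq a 0; last exact: scales_pivot.
have [i ci0] : exists i, c i 0 != 0.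
  apply/not_existsP => h.
  have c0 : c = 0.
    apply/matrixP => i j; rewrite ord1 mxE; apply/eqP; rewrite -[_ == _]negbK.
    by apply/negP; exact: h.
  by move: uA; rewrite a0 c0 unitmxE det_ublock det_scalar1 mul0r unitr0.
(* Adding row [i] of the lower blocks to the top row makes [c i 0] the pivot; the upper
   unitriangular factor undoes the addition. *)
pose r : 'rV[R]_d := delta_mx 0 i.
have rc : r *m c = (c i 0)%:M.
  by rewrite -rowE [LHS]mx11_scalar mxE.
have -> : block_mx a%:M b c D =
    block_mx 1%:M (- r) 0 1%:M *m block_mx (c i 0)%:M (b + r *m D) c D.
  rewrite mulmx_block !mul1mx !mul0mx !add0r !mulNmx rc a0 subrr addrK.
  by rewrite raddf0.
apply: scales_mul; first by apply: scales_ublock; [exact: oner_neq0|exact: scales1].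
apply: scales_pivot => //.
suff -> : block_mx (c i 0)%:M (b + r *m D) c D = block_mx 1%:M r 0 1%:M *m block_mx a%:M b c D.
  by rewrite unitmx_mul uA andbT unitmxE det_ublock !det1 mulr1 unitr1.
rewrite mulmx_block !mul1mx !mul0mx !add0r rc a0; congr block_mx.
by rewrite raddf0 add0r.
Qed.

End LinearChange.

(** * Volumes of products of simplices; hyperplanes are null *)

Section SimplexVolume.
Context {R : realType}.
Local Notation T := (measurableTypeR R).
Local Notation lambda := (@lebesgue_measure R).
Local Notation vol := (@lebesgue_volume R _).

Lemma integral_onemXn p :
  (\int[lambda]_(x in `[0%R, 1%R]) (onem x ^+ p)%:E = (p.+1%:R^-1)%:E)%E.
Proof.
rewrite (@continuous_FTC2 _ _ (fun x => onem x ^+ p.+1 / - p.+1%:R))//=.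
- by rewrite onem1 expr0n/= mul0r onem0 expr1n mul1r -EFinB sub0r invrN opprK.
- by apply: continuous_in_subspaceT => x x01; exact: continuous_onemXn.
- exact: derivable_oo_LRcontinuous_onemXnMr.
- move=> x x01; rewrite derive1Mr//; last exact: onemXn_derivable.
  by rewrite derive_onemXn mulrAC divff// mul1r.
Qed.

Lemma integral_subXn (s K : R) p : 0 <= s -> 0 <= K ->
  (\int[lambda]_(x in `[0%R, s]) (K * (s - x) ^+ p)%:E
   = (K * (s ^+ p.+1 / p.+1%:R))%:E)%E.
Proof.
rewrite le_eqVlt => /predU1P[<- K0|s0 K0].
  by rewrite set_itv1 integral_set1 expr0n/= mul0r mulr0.
rewrite integral_mkcond.
set f := (X in (\int[_]_x X x)%E).
have f0 x : (0 <= f x)%E.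
  rewrite /f patchE; case: ifPn => //; rewrite inE/= in_itv/= => /andP[x0 xs].
  by rewrite lee_fin mulr_ge0// exprn_ge0// subr_ge0.
have mf : measurable_fun setT f.
  apply/(measurable_restrictT _ _).1 => //.
  apply/measurable_EFinP/measurable_funM; first exact: measurable_cst.
  by apply: measurable_funX; apply: measurable_funB => //; exact: measurable_cst.
have := ge0_integral_affine 0 (lt0r_neq0 s0) mf f0.
rewrite gtr0_norm// => /(congr1 (fun z => s%:E * z)%E).
rewrite muleA -EFinM divff ?gt_eqF// mul1e => <-.
have -> : (\int[lambda]_x f (s * x + 0)%R =
    \int[lambda]_(x in `[0%R, 1%R]) ((K * s ^+ p)%:E * (onem x ^+ p)%:E))%E.
  rewrite [RHS]integral_mkcond; apply: eq_integral => x _.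
  rewrite /f !patchE addr0.
  have -> : (s * x \in [set` `[0, s]]) = (x \in [set` `[0, 1]]).
    rewrite !mem_setE !in_itv/= pmulr_rge0//.
    by rewrite -[X in _ * _ <= X]mulr1 ler_pM2l.
  case: ifPn => // _; rewrite -EFinM /onem -mulrA -exprMn.
  by congr (K * _ ^+ p)%:E; ring.
rewrite ge0_integralZl//=; last 3 first.
- apply/measurable_EFinP/measurable_funX; apply: measurable_funB => //; exact: measurable_cst.
- by move=> x; rewrite in_itv/= => /andP[_ x1]; rewrite lee_fin exprn_ge0// subr_ge0.
- by rewrite lee_fin mulr_ge0// exprn_ge0// ltW.
by rewrite integral_onemXn -!EFinM; congr EFin; rewrite exprS; ring.
Qed.

(** The sizes [s] and [t] are parameters because the slice of a simplex of size [s] at [x] is a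
    simplex of size [s - x]. *)
Definition simplex_product p q (s t : R) : set ((p + q).-tuple R) :=
  [set c | [/\ all (>= 0) c, \sum_(x <- take p c) x <= s
             & \sum_(x <- drop p c) x <= t]].

Lemma sum_seq_ge0 (c : seq R) : all (>= 0) c -> 0 <= \sum_(x <- c) x.
Proof. by move=> /allP c0; rewrite big_seq sumr_ge0. Qed.

Lemma lebesgue_volume_set0 d : vol (set0 : set (d.-tuple T)) = 0%E.
Proof.
by have [mu ->//] := @lebesgue_volume_is_measure R d; exact: measure0.
Qed.

(** One slicing step, shared by the inductions on the two factors; [K] holds whatever does not
    depend on the size being sliced. *)
Let volume_simplex_step d p (K s : R) (V : R -> set (d.-tuple T))
    (W : set (d.+1.-tuple T)) : 0 <= s -> 0 <= K ->
    (forall (x : T) (v : d.-tuple T), W [tuple of x :: v] <-> 0 <= x /\ V (s - x) v) ->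
    (forall r, r < 0 -> V r = set0) ->
    (forall r, 0 <= r -> vol (V r) = (K * r ^+ p)%:E) ->
  vol W = (K * (s ^+ p.+1 / p.+1%:R))%:E.
Proof.
move=> s0 K0 WE V0 VE; rewrite -(integral_subXn p s0 K0) [RHS]integral_mkcond.
apply: eq_integral => x _ /=; rewrite -/lebesgue_volume patchE.
case: ifPn => [|xs].
  rewrite inE/= in_itv/= => /andP[x0 xs].
  rewrite -VE ?subr_ge0//; congr (vol _); apply/seteqP.
  by split => v /=; rewrite WE; [case|].
rewrite -[RHS](lebesgue_volume_set0 d); congr (vol _); apply/seteqP; split => v //=.
rewrite WE => -[x0 Vv]; move/negP: xs; apply; rewrite inE/= in_itv/= x0/=.
by rewrite leNgt; apply/negP => sx; move: Vv; rewrite V0// subr_lt0.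
Qed.

Lemma volume_simplex_product p q (s t : R) : 0 <= s -> 0 <= t ->
  vol (@simplex_product p q s t) = ((s ^+ p / p`!%:R) * (t ^+ q / q`!%:R))%:E.
Proof.
move=> + t0; elim: p s => [|p IH] s s0.
  rewrite expr0 fact0 divr1 mul1r.
  elim: q t t0 => [|q IHq] t t0.
    rewrite /= expr0 fact0 divr1 diracE mem_set//.
    by rewrite /simplex_product /= big_nil.
  rewrite (@volume_simplex_step q q (q`!%:R^-1) t (@simplex_product 0 q s))//.
  - by congr EFin; rewrite factS natrM invfM; ring.
  - move=> x v; rewrite /simplex_product /= !take0 !drop0 !big_nil big_cons.
    split => [[/andP[-> ->]]|[-> [->]]]; first by rewrite lerBrDl.
    by rewrite lerBrDl.
  - move=> r r0; apply/seteqP; split => // v [v0 _].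
    by rewrite drop0 => h; move: (lt_le_trans r0 (sum_seq_ge0 v0)); rewrite ltNge h.
  - by move=> r r0; rewrite IHq// mulrC.
rewrite (@volume_simplex_step (p + q) p (p`!%:R^-1 * (t ^+ q / q`!%:R)) s
   (fun r => @simplex_product p q r t))//.
- by congr EFin; rewrite factS natrM invfM; ring.
- by rewrite mulr_ge0// mulr_ge0// exprn_ge0.
- move=> x v; rewrite /simplex_product /= big_cons.
  split => [[/andP[-> ->] h ->]|[-> [-> h ->]]]; first by rewrite lerBrDl.
  by rewrite -lerBrDl.
- move=> r r0; apply/seteqP; split => // v [v0 h _].
  have : 0 <= \sum_(x <- take p v) x.
    by apply: sum_seq_ge0; apply/allP => x /mem_take; exact/allP.
  by move=> /(lt_le_trans r0); rewrite ltNge h.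
- by move=> r r0; rewrite IH//; congr EFin; ring.
Qed.

(** If a coefficient after the first is nonzero, every slice is a hyperplane in one dimension less.
    Otherwise only the slice at [t / a ord0] is nonempty, and a point is null. *)
Lemma volume_hyperplane d (a : 'I_d -> R) (t : R) : (exists i, a i != 0) ->
  vol [set c : d.-tuple T | \sum_i a i * tnth c i = t] = 0%E.
Proof.
elim: d a t => [|d IH] a t; first by case=> -[].
case=> i ai0.
have mS : measurable [set c : d.+1.-tuple T | \sum_i a i * tnth c i = t].
  have mf : measurable_fun setT (fun c : d.+1.-tuple T => \sum_i a i * tnth c i : T).
    apply: measurable_sum_fun => j; apply: measurable_funM; first exact: measurable_cst.
    exact: measurable_tnth.
  rewrite -[X in measurable X]setTI; apply: (mf measurableT [set t]).
  exact: measurable_set1.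
have sE x (v : d.-tuple T) : (\sum_i a i * tnth [tuple of x :: v] i = t) <->
    (\sum_i a (lift ord0 i) * tnth v i = t - a ord0 * x).
  rewrite big_ord_recl (eq_bigr (fun i => a (lift ord0 i) * tnth v i)); last first.
    by move=> j _; rewrite tnthS.
  have -> : tnth [tuple of x :: v] ord0 = x by [].
 
  by split=> [<-|->]; ring.
have [tz|tz] := pselect (exists i, a (lift ord0 i) != 0).
  apply: integral0_eq => x _; rewrite -/lebesgue_volume -(IH _ (t - a ord0 * x) tz).
  by congr (vol _); apply/seteqP; split => v /=; rewrite sE.
have a0 : a ord0 != 0.
  case: (unliftP ord0 i) ai0 => [j ->|-> //] aj.
  by exfalso; apply: tz; exists j.
have z j : a (lift ord0 j) = 0.
  by apply/eqP; rewrite -[_ == _]negbK; apply/negP => h; apply: tz; exists j.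
transitivity (\int[lambda]_x (cst 0%E : T -> \bar R) x)%E; last exact: integral0.
apply: ae_eq_integral => //.
  exact: measurable_fun_section_volume.
exists [set t / a ord0]; split.
- exact: measurable_set1.
- exact: lebesgue_measure_set1.
- move=> x /= h; apply/not_notP => xt; apply: h => _.
  rewrite -(lebesgue_volume_set0 d); congr (vol _); apply/seteqP; split => v //=.
  rewrite sE big1; last by move=> j _; rewrite z mul0r.
  by move=> /esym/subr0_eq h; apply: xt; rewrite h mulrAC divff// mul1r.
Qed.

End SimplexVolume.

(** * Computing the normalized volume in one lattice chart *)

Section LatticeVolume.
Context {R : realType}.
Local Notation T := (measurableTypeR R).
Local Notation vol := (@lebesgue_volume R _).

Lemma lattice_chartE m d (p : 'rV[R]_m) (B : 'M[int]_(d, m)) (c : d.-tuple R) :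
  lattice_chart p B c = p + row_of_tuple c *m map_mx intr B.
Proof. by []. Qed.

Lemma map_intr_inj m d : injective (map_mx (intr : int -> R) : 'M[int]_(m, d) -> 'M[R]_(m, d)).
Proof.
move=> A B /matrixP AB; apply/matrixP => i j.
by move: (AB i j); rewrite !mxE => /intr_inj.
Qed.

Let lattice_basis_span m d d' (P : set 'rV[R]_m) (B : 'M[int]_(d, m)) (B' : 'M[int]_(d', m)) :
  lattice_basis P B -> lattice_basis P B' -> exists U : 'M[int]_(d', d), B' = U *m B.
Proof.
move=> [_ _ intB] [_ dirB' _].
have h i : exists c : 'rV[int]_d, row i B' = c *m B.
  by apply: intB; apply/dirB'; rewrite map_row row_sub.
have [f fE] := choice h.
exists (\matrix_i f i); apply/row_matrixP => i.
by rewrite row_mul rowK -fE.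
Qed.

Let lattice_basis_rank m d (P : set 'rV[R]_m) (B : 'M[int]_(d, m)) d' (B' : 'M[int]_(d', m)) :
  lattice_basis P B -> lattice_basis P B' -> d' = d.
Proof.
move=> [/eqP rB dB _] [/eqP rB' dB' _].
rewrite -rB -rB'; apply/eqP; rewrite eqn_leq; apply/andP; split.
  by apply/mxrankS/row_subP => i; apply/dB/dB'; rewrite row_sub.
by apply/mxrankS/row_subP => i; apply/dB'/dB; rewrite row_sub.
Qed.

Lemma normalized_volume_chart m d (P : set 'rV[R]_m) (B : 'M[int]_(d, m)) (p : 'rV[R]_m) :
    lattice_basis P B -> affine_hull P p ->
    measurable (lattice_chart p B @^-1` P : set (d.-tuple T)) ->
  normalized_volume P = (d`!%:R%:E * vol (lattice_chart p B @^-1` P))%E.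
Proof.
move=> basB hp mS; rewrite /normalized_volume.
set X := [set v | _].
have Xv : X (d`!%:R%:E * vol (lattice_chart p B @^-1` P))%E by exists d, B, p.
have [d' [B' [q [basB' hq ->]]]] : X (xget 0%E X) by exact: xgetI Xv.
have dd := lattice_basis_rank basB basB'; subst d'.
have [U UE] := lattice_basis_span basB basB'.
have [V VE] := lattice_basis_span basB' basB.
have [rB dB _] := basB.
(* The transition matrices between the two bases are integral and, by row freeness, inverse to each
   other, so [\det U] is a unit of Z. *)
have VU : V *m U = 1%:M.
  apply: (@map_intr_inj d d); apply: (row_free_inj rB).
  by rewrite -!map_mxM /= -mulmxA -UE -VE mul1mx.
have detU : `|\det U| = 1.
  have : \det V * \det U = 1 by rewrite -det_mulmx VU det1.
  by move=> /intUnitRing.unitzPl /orP[] /eqP ->.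
have [t tE] : exists t : 'rV[R]_d, q = p + t *m map_mx intr B.
  have : direction P (q - p) by exists q, p.
  by move=> /dB /submxP[t tE]; exists t; rewrite -tE addrC subrK.
congr (_ * _)%E.
have -> : lattice_chart q B' @^-1` P =
    affine_map (map_mx intr U) t @^-1` (lattice_chart p B @^-1` P).
  apply/seteqP; split => c /=; rewrite !lattice_chartE tuple_of_rowK mulmxDl tE UE;
  by rewrite map_mxM mulmxA addrAC -addrA.
rewrite lebesgue_volume_affine//.
  by rewrite det_map_mx /= -intr_norm detU invr1 mul1e.
by rewrite unitmxE det_map_mx unitfE intr_eq0 -normr_eq0 detU.
Qed.

(** The integral right inverse [D] shows at once that the rows of [B] are independent and that an
    integer vector in their real span has integer coordinates [z *m D]. The strictly positive point
    [c0] makes the affine hull fill the whole affine subspace. *)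
Lemma lattice_basis_polyhedron m d (P : set 'rV[R]_m) (B : 'M[int]_(d, m))
    (D : 'M[int]_(m, d)) (p c0 : 'rV[R]_m) : B *m D = 1%:M ->
    (forall f, P f <-> (forall e, 0 <= f 0 e) /\ (f - p <= map_mx intr B)%MS) ->
    (c0 - p <= map_mx intr B)%MS -> (forall e, 0 < c0 0 e) ->
  lattice_basis P B /\ affine_hull P p.
Proof.
move=> BD PE c0p c0gt; pose BR : 'M[R]_(d, m) := map_mx intr B.
rewrite -/BR in c0p PE.
have addp f g : (f - p <= BR)%MS -> (g <= BR)%MS -> (f + g - p <= BR)%MS.
  by move=> fp gp; rewrite addrAC addmx_sub.
have hullE f : affine_hull P f <-> (f - p <= BR)%MS.
  split=> [[s [t [y [Py t1 ->]]]]|fp].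
    have -> : \sum_i t i *: y i - p = \sum_i t i *: (y i - p).
      rewrite [RHS](eq_bigr (fun i => t i *: y i - t i *: p)); last by move=> i _; rewrite scalerBr.
      by rewrite sumrB -scaler_suml t1 scale1r.
    apply: summx_sub => i _; apply: scalemx_sub.
    by case: (PE (y i)) => /(_ (Py i)) [].
  have Pc0 : P c0 by apply/PE; split => // e; exact: ltW.
  (* [M] is large enough that going only the fraction 1 / M of the way from [c0] to [f] keeps every
     coordinate nonnegative. Then [f] is the affine combination of [g] and [c0] with weights [M] and
     [1 - M]. *)
  pose M := 1 + \sum_e `|f 0 e - c0 0 e| / c0 0 e.
  have tge0 e : 0 <= `|f 0 e - c0 0 e| / c0 0 e by rewrite divr_ge0// ltW.
  have M0 : 0 < M by rewrite ltr_pwDl// sumr_ge0.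
  pose g := c0 + M^-1 *: (f - c0).
  have fc0 : (f - c0 <= BR)%MS.
    have -> : f - c0 = (f - p) - (c0 - p) by rewrite opprB addrA subrK.
    by rewrite addmx_sub// eqmx_opp.
  have Pg : P g.
    apply/PE; split; last by apply: addp => //; exact: scalemx_sub.
    move=> e; rewrite !mxE.
    have : `|f 0 e - c0 0 e| <= M * c0 0 e.
      rewrite -ler_pdivrMr// /M (bigD1 e)//= [in leRHS]addrCA lerDl.
      by rewrite addr_ge0// sumr_ge0.
    rewrite ler_norml => /andP[h _].
    by rewrite -(pmulr_rge0 _ M0) mulrDr mulVKf ?gt_eqF// -lerBlDl sub0r.
  exists 2%N, (fun i => if i == ord0 then M else 1 - M), (fun i => if i == ord0 then g else c0).
  split.
  - by move=> i; case: ifP.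
  - by rewrite !big_ord_recl big_ord0 /= addr0 addrC subrK.
  - rewrite !big_ord_recl big_ord0 /= addr0 scalerDr scalerA divff ?gt_eqF// scale1r.
    by apply/rowP => e; rewrite !mxE; ring.
have dirE v : direction P v <-> (v <= BR)%MS.
  split=> [[x [y [/hullE xp /hullE yp ->]]]|vB].
    have -> : x - y = (x - p) - (y - p) by rewrite opprB addrA subrK.
    by rewrite addmx_sub// eqmx_opp.
  exists (c0 + v), c0; split; first by apply/hullE; exact: addp.
    exact/hullE.
  by rewrite addrC addKr.
have BDR : BR *m map_mx intr D = 1%:M by rewrite -map_mxM BD map_mx1.
split; last by apply/hullE; rewrite subrr sub0mx.
split=> //.
- by apply/row_freeP; exists (map_mx intr D).
- move=> z /dirE /submxP[u zE]; exists (z *m D); apply: map_intr_inj.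
  by rewrite !map_mxM /= zE -/BR -[X in X *m BR]mulmxA BDR mulmx1.
Qed.

End LatticeVolume.

(** * Affine functions with integral linear part *)

Section IntegralAffine.
Context {R : realType}.
Local Notation T := (measurableTypeR R).
Local Notation vol := (@lebesgue_volume R _).

(** The linear parts become the columns of a lattice basis and must be integral; the constants only
    enter the origin of the chart and may be real. *)
Definition int_affine d (g : d.-tuple R -> R) := exists (t : R) (b : 'I_d -> int),
  forall c, g c = t + \sum_i (b i)%:~R * tnth c i.

Lemma int_affine_ext d (g h : d.-tuple R -> R) : g =1 h -> int_affine g -> int_affine h.
Proof. by move=> gh [t [b gE]]; exists t, b => c; rewrite -gh. Qed.

Lemma int_affine_cst d (x : R) : int_affine (fun _ : d.-tuple R => x).
Proof. by exists x, (fun=> 0) => c; rewrite big1 ?addr0// => i _; rewrite mul0r. Qed.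

Lemma int_affine_nth d i : (i < d)%N -> int_affine (fun c : d.-tuple R => c`_i).
Proof.
move=> id; exists 0, (fun j => (j == Ordinal id)%:R) => c.
rewrite add0r (bigD1 (Ordinal id))//= eqxx mul1r big1 ?addr0 ?(tnth_nth 0)//.
by move=> j /negPf ->; rewrite mul0r.
Qed.

Lemma int_affineD d (g h : d.-tuple R -> R) : int_affine g -> int_affine h ->
  int_affine (fun c => g c + h c).
Proof.
move=> [t [b gE]] [u [a hE]]; exists (t + u), (fun i => b i + a i) => c.
rewrite gE hE addrACA; congr (_ + _); rewrite -big_split /=.
by apply: eq_bigr => i _; rewrite intrD mulrDl.
Qed.

Lemma int_affineN d (g : d.-tuple R -> R) : int_affine g -> int_affine (fun c => - g c).
Proof.
move=> [t [b gE]]; exists (- t), (fun i => - b i) => c.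
by rewrite gE opprD -sumrN; congr (_ + _); apply: eq_bigr => i _; rewrite mulrNz mulNr.
Qed.

Lemma int_affineB d (g h : d.-tuple R -> R) : int_affine g -> int_affine h ->
  int_affine (fun c => g c - h c).
Proof. by move=> ag ah; apply: int_affineD => //; exact: int_affineN. Qed.

Lemma int_affine_sum d (I : eqType) (r : seq I) (P : pred I) (g : I -> d.-tuple R -> R) :
  (forall i, i \in r -> P i -> int_affine (g i)) ->
  int_affine (fun c => \sum_(i <- r | P i) g i c).
Proof.
elim: r => [|i r IH] ag.
  by apply: int_affine_ext (int_affine_cst d 0) => c; rewrite big_nil.
have {}IH := IH (fun j jr => ag j (mem_behead (s := i :: r) jr)).
case Pi : (P i); last by apply: int_affine_ext IH => c; rewrite big_cons Pi.
have ai := ag i (mem_head _ _) Pi.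
by apply: int_affine_ext (int_affineD ai IH) => c; rewrite big_cons Pi.
Qed.

Lemma measurable_int_affine d (g : d.-tuple R -> R) :
  int_affine g -> measurable_fun setT (g : d.-tuple T -> T).
Proof.
move=> [t [b gE]].
have -> : g = (fun c => t + \sum_i (b i)%:~R * tnth c i) by exact/funext.
apply: measurable_funD; first exact: measurable_cst.
apply: measurable_sum_fun => i; apply: measurable_funM; first exact: measurable_cst.
exact: measurable_tnth.
Qed.

Lemma measurable_int_affine_ge0 d (g : d.-tuple R -> R) : int_affine g ->
  measurable ([set c | 0 <= g c] : set (d.-tuple T)).
Proof.
move=> /measurable_int_affine mg.
have -> : [set c | 0 <= g c] = setT `&` g @^-1` [set` `[0, +oo[].
  by rewrite setTI; apply/seteqP; split => c /=; rewrite in_itv/= andbT.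
by apply: mg => //; exact: measurable_itv.
Qed.

Lemma measurable_forall_ge0 d n (g : nat -> d.-tuple R -> R) :
    (forall i, (i < n)%N -> int_affine (g i)) ->
  measurable ([set c | forall i, (i < n)%N -> 0 <= g i c] : set (d.-tuple T)).
Proof.
move=> ag.
have -> : [set c | forall i, (i < n)%N -> 0 <= g i c] =
    \bigcap_(i in `I_n) [set c | 0 <= g i c] by [].
apply: fin_bigcap_measurable; first exact: finite_II.
by move=> i /= /ag; exact: measurable_int_affine_ge0.
Qed.

Lemma int_affine_chart d m (F : 'I_m -> d.-tuple R -> R) :
    (forall e, int_affine (F e)) ->
  exists (B : 'M[int]_(d, m)) (p : 'rV[R]_m),
    forall c, \row_e F e c = lattice_chart p B c.
Proof.
move=> aF; have [t tE] := choice aF; have [b bE] := choice tE.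
exists (\matrix_(i, e) b e i), (\row_e t e) => c.
apply/rowP => e; rewrite !mxE bE; congr (_ + _).
by apply: eq_bigr => i _; rewrite !mxE mulrC.
Qed.

Lemma int_affine_affine_map d (f : d.-tuple R -> d.-tuple R) :
    (forall i, int_affine (fun c => tnth (f c) i)) ->
  exists A t, f =1 affine_map A t.
Proof.
move=> af; have [B [p fE]] := int_affine_chart af.
exists (map_mx intr B), p => c; rewrite /affine_map addrC.
by rewrite -[f c]row_of_tupleK [X in tuple_of_row X]fE.
Qed.

(** Two points with different values certify a nonzero linear part without any computation of
    coefficients. *)
Lemma volume_int_affine_eq0 d (g : d.-tuple R -> R) (c1 c2 : d.-tuple R) :
  int_affine g -> g c1 != g c2 -> vol [set c | g c = 0] = 0%E.
Proof.
move=> [t [b gE]] g12.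
have [[i bi]|b0] := pselect (exists i, (b i)%:~R != 0 :> R); last first.
  case/eqP: g12; rewrite !gE !big1 // => i _; apply/eqP; rewrite mulf_eq0; apply/orP; left;
  by rewrite -[_ == _]negbK; apply/negP => bi; apply: b0; exists i.
rewrite -(@volume_hyperplane R d (fun i => (b i)%:~R) (- t)); last by exists i.
congr (vol _); apply/seteqP; split => c /=; rewrite gE.
  by move=> /eqP; rewrite addrC addr_eq0 => /eqP.
by move=> ->; rewrite subrr.
Qed.

(* The Jacobian of [f] is 1 because [f] preserves a set of finite positive
   volume. *)
Lemma volume_preserving d (f : d.-tuple R -> d.-tuple R) (K : set (d.-tuple T)) (x : R)
    (S : set (d.-tuple T)) :
    (forall i, int_affine (fun c => tnth (f c) i)) -> injective f ->
    measurable K -> f @^-1` K = K -> 0 < x -> vol K = x%:E -> measurable S ->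
  measurable (f @^-1` S : set (d.-tuple T)) /\ vol (f @^-1` S) = vol S.
Proof.
move=> af injf mK fK x0 volK mS.
have [A [t /funext fE]] := int_affine_affine_map af.
have uA : A \in unitmx.
  rewrite -row_free_unit -kermx_eq0; apply/eqP/row_matrixP => i; rewrite row0.
  have kA : row i (kermx A) *m A = 0 by rewrite -row_mul mulmx_ker row0.
  apply: (can_inj (@tuple_of_rowK R d)); apply: injf.
  by rewrite fE /affine_map !tuple_of_rowK kA mul0mx.
rewrite fE in fK *; split; first exact: measurable_affine_preimage.
rewrite lebesgue_volume_affine//.
have : (`|\det A|^-1)%:E = 1%E :> \bar R.
  have := @lebesgue_volume_affine R d A t K uA mK.
  rewrite fK volK -EFinM => -[] /(congr1 (fun z => z / x)).
  by rewrite mulfK ?gt_eqF// divff ?gt_eqF// => <-.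
by move=> ->; rewrite mul1e.
Qed.

End IntegralAffine.

(** * The cycle lemma for products of simplices *)

Section CycleLemma.
Context {R : realType}.
Local Notation T := (measurableTypeR R).
Local Notation vol := (@lebesgue_volume R _).
Variables k p q : nat.

Local Notation tup := ((p + q).-tuple R).
Implicit Type c : tup.

(* For the caracol graph, [ycoord c (j * k + i)] is the flow on the edge
   [i + 1 -> k + j + 1] and [wcoord c j] the flow on [k + j + 1 -> n + 1].  Both
   families sum to 1, so only [p] and [q] of them are free coordinates. *)
Definition ycoord c i := if (i < p)%N then c`_i else 1 - \sum_(0 <= j < p) c`_j.

Definition wcoord c i :=
  if (i < q)%N then c`_(p + i) else 1 - \sum_(0 <= j < q) c`_(p + j).

Definition excess c j :=
  \sum_(0 <= i < j * k) ycoord c i - \sum_(0 <= i < j) wcoord c i.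

Lemma sum_ycoord c : \sum_(0 <= i < p.+1) ycoord c i = 1.
Proof.
rewrite big_nat_recr//= {2}/ycoord ltnn.
rewrite (eq_big_nat _ _ (F2 := fun i => c`_i)) ?subrK//; last first.
  by move=> i /andP[_ ip]; rewrite /ycoord ip.
by rewrite addrC subrK.
Qed.

Lemma sum_wcoord c : \sum_(0 <= i < q.+1) wcoord c i = 1.
Proof.
rewrite big_nat_recr//= {2}/wcoord ltnn.
rewrite (eq_big_nat _ _ (F2 := fun i => c`_(p + i))); last first.
  by move=> i /andP[_ ip]; rewrite /wcoord ip.
by rewrite addrC subrK.
Qed.

Lemma excess0 c : excess c 0 = 0.
Proof. by rewrite /excess mul0n !big_geq// subrr. Qed.

Lemma ycoord_inj c c' : (forall i, (i < p.+1)%N -> ycoord c i = ycoord c' i) ->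
  (forall i, (i < q.+1)%N -> wcoord c i = wcoord c' i) -> c = c'.
Proof.
move=> hy hw; apply/eq_from_tnth => i; rewrite !(tnth_nth 0).
have [ip|ip] := ltnP i p.
  by have := hy i (ltnW ip); rewrite /ycoord ip.
have iq : (i - p < q)%N by have := ltn_ord i; lia.
by have := hw (i - p)%N (ltnW iq); rewrite /wcoord iq subnKC.
Qed.

(** The entries of [y] are listed column by column, [k] to a column, so shifting the flat index by
    [k] rotates the columns by one. Only the free coordinates are stored; the dependent ones follow
    because rotation preserves the totals. *)
Definition rotate c : tup :=
  [tuple if (i < p)%N then ycoord c ((i + k) %% p.+1)
         else wcoord c ((i - p).+1 %% q.+1) | i < p + q].

Lemma nth_rotate c i : (i < p + q)%N -> (rotate c)`_i =
  if (i < p)%N then ycoord c ((i + k) %% p.+1) else wcoord c ((i - p).+1 %% q.+1).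
Proof. by move=> ipq; rewrite -[i]/(val (Ordinal ipq)) nth_mktuple. Qed.

Let sum_modn n j (f : nat -> R) :
  \sum_(0 <= i < n.+1) f ((i + j) %% n.+1)%N = \sum_(0 <= i < n.+1) f i.
Proof.
rewrite !big_mkord.
pose h (i : 'I_n.+1) : 'I_n.+1 := Ordinal (ltn_pmod (i + j) (ltn0Sn n)).
rewrite [RHS](reindex_inj (h := h))//= => x y /(congr1 val)/= /eqP.
rewrite eqn_modDr !modn_small// => /eqP; exact: val_inj.
Qed.

Lemma ycoord_rotate c i : (i < p.+1)%N -> ycoord (rotate c) i = ycoord c ((i + k) %% p.+1).
Proof.
have small j : (j < p)%N -> (rotate c)`_j = ycoord c ((j + k) %% p.+1).
  by move=> jp; rewrite nth_rotate ?jp//; lia.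
rewrite ltnS leq_eqVlt => /predU1P[->|ip]; last by rewrite {1}/ycoord ip small.
rewrite {1}/ycoord ltnn; have := sum_modn p k (ycoord c); rewrite sum_ycoord big_nat_recr//= => <-.
rewrite [X in _ - X](eq_big_nat _ _ (F2 := fun j => ycoord c ((j + k) %% p.+1))).
  by rewrite addrAC subrr add0r.
by move=> j /andP[_ jp]; exact: small.
Qed.

Lemma wcoord_rotate c i : (i < q.+1)%N -> wcoord (rotate c) i = wcoord c (i.+1 %% q.+1).
Proof.
have small j : (j < q)%N -> (rotate c)`_(p + j) = wcoord c ((j + 1) %% q.+1).
  by move=> jq; rewrite nth_rotate ?ltn_add2l// ltnNge leq_addr/= addKn addn1.
move=> iq; rewrite -[in RHS]addn1; move: iq.
rewrite ltnS leq_eqVlt => /predU1P[->|ip]; last by rewrite {1}/wcoord ip small.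
rewrite {1}/wcoord ltnn; have := sum_modn q 1 (wcoord c); rewrite sum_wcoord big_nat_recr//= => <-.
rewrite [X in _ - X](eq_big_nat _ _ (F2 := fun j => wcoord c ((j + 1) %% q.+1))).
  by rewrite addrAC subrr add0r.
by move=> j /andP[_ jp]; exact: small.
Qed.

Lemma rotate_inj : injective rotate.
Proof.
move=> c c' cc; apply: ycoord_inj => i ip.
  (* [p.+1 * k - k] is a natural number representing [-k] modulo [p.+1], so this index is sent to
     [i]; for [wcoord] the shift [q] represents -1 modulo [q.+1]. *)
  have := congr1 (fun c => ycoord c ((i + (p.+1 * k - k)) %% p.+1)) cc.
  rewrite /= !ycoord_rotate ?ltn_pmod// modnDml -addnA subnK; last nia.
  by rewrite (addnC i) mulnC modnMDl modn_small.
have := congr1 (fun c => wcoord c ((i + q) %% q.+1)) cc.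
rewrite /= !wcoord_rotate ?ltn_pmod//.
by rewrite -addn1 modnDml -addnA addn1 modnDr modn_small.
Qed.

Lemma int_affine_ycoord i : int_affine (ycoord^~ i).
Proof.
have [ip|ip] := ltnP i p.
  apply: (@int_affine_ext _ _ (fun c => c`_i)); first by move=> c; rewrite /ycoord ip.
  by apply: int_affine_nth; lia.
apply: (@int_affine_ext _ _ (fun c => 1 - \sum_(0 <= j < p) c`_j)).
  by move=> c; rewrite /ycoord ltnNge ip.
apply: int_affineB; first exact: int_affine_cst.
by apply: int_affine_sum => j; rewrite mem_index_iota => jp _; apply: int_affine_nth; lia.
Qed.

Lemma int_affine_wcoord i : int_affine (wcoord^~ i).
Proof.
have [iq|iq] := ltnP i q.
  apply: (@int_affine_ext _ _ (fun c => c`_(p + i))); first by move=> c; rewrite /wcoord iq.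
  by apply: int_affine_nth; lia.
apply: (@int_affine_ext _ _ (fun c => 1 - \sum_(0 <= j < q) c`_(p + j))).
  by move=> c; rewrite /wcoord ltnNge iq.
apply: int_affineB; first exact: int_affine_cst.
by apply: int_affine_sum => j; rewrite mem_index_iota => jp _; apply: int_affine_nth; lia.
Qed.

Lemma int_affine_excess j : int_affine (excess^~ j).
Proof.
apply: int_affineB; apply: int_affine_sum => i _ _.
  exact: int_affine_ycoord.
exact: int_affine_wcoord.
Qed.

Lemma int_affine_rotate i : int_affine (fun c => tnth (rotate c) i).
Proof.
apply: (@int_affine_ext _ _ (fun c => if (i < p)%N then ycoord c ((i + k) %% p.+1)
   else wcoord c ((i - p).+1 %% q.+1))).
  by move=> c; rewrite tnth_mktuple.
case: (i < p)%N; first exact: int_affine_ycoord.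
exact: int_affine_wcoord.
Qed.

Definition simplices : set tup :=
  [set c | (forall i, (i < p.+1)%N -> 0 <= ycoord c i) /\
           (forall i, (i < q.+1)%N -> 0 <= wcoord c i)].

Definition dominated : set tup :=
  [set c | simplices c /\ forall j, (j < q.+1)%N -> 0 <= excess c j].

Lemma measurable_simplices : measurable (simplices : set ((p + q).-tuple T)).
Proof.
apply: measurableI; apply: measurable_forall_ge0 => i _.
  exact: int_affine_ycoord.
exact: int_affine_wcoord.
Qed.

Lemma measurable_dominated : measurable (dominated : set ((p + q).-tuple T)).
Proof.
apply: measurableI; first exact: measurable_simplices.
by apply: measurable_forall_ge0 => i _; exact: int_affine_excess.
Qed.

Lemma simplicesE : simplices = @simplex_product R p q 1 1.
Proof.
have sumtake c : \sum_(x <- take p c) x = \sum_(0 <= j < p) c`_j.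
  rewrite (big_nth 0) size_take size_tuple -/(minn p (p + q)) (minn_idPl (leq_addr _ _)).
  by apply: eq_big_nat => i /andP[_ ip]; rewrite nth_take.
have sumdrop c : \sum_(x <- drop p c) x = \sum_(0 <= j < q) c`_(p + j).
  rewrite (big_nth 0) size_drop size_tuple addKn.
  by apply: eq_big_nat => i _; rewrite nth_drop.
apply/seteqP; split => c.
  move=> [y0 w0]; split.
  - apply/(all_nthP 0) => i; rewrite size_tuple => ipq.
    have [ip|ip] := ltnP i p; first by have := y0 i (ltnW ip); rewrite /ycoord ip.
    have iq : (i - p < q)%N by lia.
    by have := w0 _ (ltnW iq); rewrite /wcoord iq subnKC.
  - by have := y0 p (ltnSn _); rewrite /ycoord ltnn subr_ge0 sumtake.
  - by have := w0 q (ltnSn _); rewrite /wcoord ltnn subr_ge0 sumdrop.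
rewrite /simplex_product /= sumtake sumdrop => -[/(all_nthP 0) c0 c1 c2].
rewrite size_tuple in c0.
split => i _; rewrite /ycoord /wcoord; case: ifP => ipq; rewrite ?subr_ge0//.
  by apply: c0; lia.
by apply: c0; lia.
Qed.

Lemma volume_simplices : vol simplices = (p`!%:R^-1 * q`!%:R^-1)%:E.
Proof. by rewrite simplicesE volume_simplex_product// !expr1n !mul1r. Qed.

Lemma simplices_rotate : rotate @^-1` simplices = simplices.
Proof.
apply/seteqP; split => c /= [hy hw].
  split => i ip.
    have := hy _ (ltn_pmod (i + (p.+1 * k - k)) (ltn0Sn p)).
    rewrite ycoord_rotate ?ltn_pmod// modnDml -addnA subnK; last nia.
    by rewrite (addnC i) mulnC modnMDl modn_small.
  have := hw _ (ltn_pmod (i + q) (ltn0Sn q)).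
  rewrite wcoord_rotate ?ltn_pmod//.
  by rewrite -addn1 modnDml -addnA addn1 modnDr modn_small.
split => i ip.
  by rewrite ycoord_rotate//; apply: hy; rewrite ltn_pmod.
by rewrite wcoord_rotate//; apply: hw; rewrite ltn_pmod.
Qed.

(** Rotation permutes the barycentric coordinates of each simplex, so [simplices] is the invariant
    set of finite positive volume that forces the Jacobian to be 1. *)
Lemma volume_iter_rotate r (S : set ((p + q).-tuple T)) : measurable S ->
  measurable (iter r rotate @^-1` S : set ((p + q).-tuple T)) /\
  vol (iter r rotate @^-1` S) = vol S.
Proof.
elim: r S => [//|r IH] S mS.
have -> : iter r.+1 rotate @^-1` S = iter r rotate @^-1` (rotate @^-1` S) by [].
have [mrS <-] := volume_preserving int_affine_rotate rotate_inj measurable_simplices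
  simplices_rotate (x := p`!%:R^-1 * q`!%:R^-1)
  ltac:(by rewrite mulr_gt0// invr_gt0 ltr0n fact_gt0) volume_simplices mS.
exact: IH.
Qed.

Hypothesis kq : (q.+1 * k)%N = p.+1.

Lemma excess_last c : excess c q.+1 = 0.
Proof. by rewrite /excess kq sum_ycoord sum_wcoord subrr. Qed.

(** For [j] at most [q] the shifted indices do not wrap around: the partial sums merely lose the
    first column and the first entry of [w]. *)
Lemma excess_rotate c j : (j < q.+1)%N -> excess (rotate c) j = excess c j.+1 - excess c 1.
Proof.
move=> jq; have jk : (j * k + k <= p.+1)%N by rewrite -kq; nia.
have -> : excess (rotate c) j =
    \sum_(k <= i < j.+1 * k) ycoord c i - \sum_(1 <= i < j.+1) wcoord c i.
  congr (_ - _).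
    rewrite -[RHS]/(\sum_(0 + k <= i < j.+1 * k) ycoord c i) big_addn mulSn addKn.
    apply: eq_big_nat => i /andP[_ ij].
    by rewrite ycoord_rotate ?modn_small//; lia.
  rewrite big_add1 /=; apply: eq_big_nat => i /andP[_ ij].
  by rewrite wcoord_rotate ?modn_small//; lia.
rewrite /excess mul1n.
rewrite [in RHS](big_cat_nat _ (n := k))//=; last by rewrite mulSn leq_addr.
rewrite [X in _ = _ + _ - X - _](big_cat_nat _ (n := 1))//=.
ring.
Qed.

Lemma excess_iter_rotate c r j : (r < q.+1)%N -> (j < q.+1)%N ->
  excess (iter r rotate c) j = excess c ((j + r) %% q.+1) - excess c r.
Proof.
elim: r j => [|r IH] j rq jq; first by rewrite addn0 modn_small// excess0 subr0.
rewrite iterS excess_rotate//.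
(* The walk is closed, so its values at 0 and [q.+1] agree and the index may be reduced modulo
   [q.+1]. *)
have -> : excess (iter r rotate c) j.+1 = excess (iter r rotate c) (j.+1 %% q.+1).
  move: jq; rewrite ltnS leq_eqVlt => /predU1P[->|jq].
    by rewrite modnn excess0 excess_last.
  by rewrite modn_small.
rewrite !IH ?ltn_pmod//; try lia.
rewrite modnDml add1n (modn_small rq) addSnnS.
ring.
Qed.

Definition argmin_excess r : set tup :=
  [set c | simplices c /\ forall j, (j < q.+1)%N -> excess c r <= excess c j].

(** The excesses of the [r]-th rotate are the differences [excess c j - excess c r], with [j]
    running over all residues. *)
Lemma iter_rotate_dominated r : (r < q.+1)%N ->
  iter r rotate @^-1` dominated = argmin_excess r.
Proof.
move=> rq.
have sr c : simplices (iter r rotate c) <-> simplices c.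
  elim: r {rq} => [//|r IH]; rewrite iterS -IH -[in X in _ <-> X]simplices_rotate.
  by [].
apply/seteqP; split => c /= [/sr sc h]; split => // j jq; last first.
  by rewrite excess_iter_rotate// subr_ge0; apply: h; rewrite ltn_pmod.
have := h _ (ltn_pmod (j + (q.+1 - r)) (ltn0Sn q)).
rewrite excess_iter_rotate ?ltn_pmod// modnDml -addnA subnK; last exact: ltnW.
by rewrite modnDr modn_small// subr_ge0.
Qed.

Lemma volume_excess_tie i j : (i < j)%N -> (j < q.+1)%N ->
  vol [set c | excess c i = excess c j] = 0%E.
Proof.
move=> ij jq.
(* At [delta (p + n)] all of [y] sits in its very last entry, which no excess of index at most [q]
   counts, and all of [w] sits at [n]; for [n = q] the tuple is zero and the dependent entry of [w]
   is 1. So [excess i - excess j] is 1 at [n = i] and 0 at [n = q]. *)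
pose delta n : tup := [tuple (x == n :> nat)%:R | x < p + q].
have nth_delta n x : (x < p + q)%N -> (delta n)`_x = (x == n)%:R.
  by move=> xpq; rewrite -[x in LHS]/(val (Ordinal xpq)) nth_mktuple.
have k0 : (0 < k)%N by case: (posnP k) kq => [->|//]; rewrite muln0.
have E n h : (h < q.+1)%N -> excess (delta (p + n)) h = - (n < h)%:R.
  move=> hq; rewrite /excess.
  rewrite big_nat big1 ?sub0r => [|x /andP[_ xh]]; last first.
    have xp : (x < p)%N by nia.
    by rewrite /ycoord xp nth_delta; [have -> : x == (p + n)%N = false by lia|lia].
  congr (- _); rewrite (eq_big_nat _ _ (F2 := fun x => (x == n)%:R)); last first.
    move=> x /andP[_ xh]; have xq : (x < q)%N by lia.
    by rewrite /wcoord xq nth_delta ?ltn_add2l// eqn_add2l.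
  rewrite big_mkord; have [nh|nh] := ltnP n h.
    rewrite (bigD1 (Ordinal nh))//= eqxx big1 ?addr0// => x /negPf xn.
    by have -> : (x == n :> nat) = false by rewrite -xn.
  rewrite big1// => x _; have -> : (x == n :> nat) = false by have := ltn_ord x; lia.
  by [].
rewrite -[RHS](@volume_int_affine_eq0 R _ (fun c => excess c i - excess c j)
   (delta (p + i)%N) (delta (p + q)%N)).
- by congr (vol _); apply/seteqP; split => c /=; [move=> ->; rewrite subrr|move=> /subr0_eq].
- by apply: int_affineB; exact: int_affine_excess.
- rewrite !E//; try lia.
  have [-> -> -> ->] : [/\ (i < i = false)%N, (i < j = true)%N, (q < i = false)%N & (q < j = false)%N].
    by split; lia.
  by rewrite oppr0 sub0r opprK subr0 oner_eq0.
Qed.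

(* Cycle lemma: the rotates of [dominated] are the cells of [simplices] cut out
   by the position of the smallest excess, and they overlap only on ties. *)
Lemma volume_dominated : (q.+1%:R%:E * vol dominated)%E = vol simplices.
Proof.
have [mu muE] := @lebesgue_volume_is_measure R (p + q).
have mD := measurable_dominated.
have mS := measurable_simplices.
have mA r : (r < q.+1)%N -> measurable (argmin_excess r : set ((p + q).-tuple T)).
  by move=> rq; rewrite -(iter_rotate_dominated rq); case: (volume_iter_rotate r mD).
have mZ i j : measurable ([set c | excess c i = excess c j] : set ((p + q).-tuple T)).
  have mf : measurable_fun setT ((fun c => excess c i - excess c j) : (p + q).-tuple T -> T).
    by apply: measurable_int_affine; apply: int_affineB; exact: int_affine_excess.
  have := mf measurableT [set 0] (measurable_set1 _); rewrite setTI.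
  by congr measurable; apply/seteqP; split => c /=; [move=> /subr0_eq|move=> ->; rewrite subrr].
pose tie i j : set ((p + q).-tuple T) :=
  if (i < j)%N then [set c | excess c i = excess c j] else set0.
(* Off the null set [Z] of all ties the cells are disjoint and keep their measures, so finite
   additivity applies exactly. *)
pose Z : set ((p + q).-tuple T) :=
  \big[setU/set0]_(i < q.+1) \big[setU/set0]_(j < q.+1) tie i j.
have [mZ0 Z0] : measurable Z /\ mu Z = 0%E.
  pose null X := measurable X /\ mu X = 0%E.
  have null0 : null set0 by split; [exact: measurable0|exact: measure0].
  have nullU X Y : null X -> null Y -> null (X `|` Y).
    move=> [mX X0] [mY Y0]; split; first exact: measurableU.
    apply/eqP; rewrite -measure_le0 (le_trans (measureU2 mu mX mY))//.
    by rewrite [X in (X + _)%E]X0 [X in (_ + X)%E]Y0 adde0.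
  apply: (big_ind null) => // i _; apply: (big_ind null) => // j _.
  rewrite /tie; case: ifPn => // ij; split; first exact: mZ.
  by rewrite -muE//; apply: volume_excess_tie.
have notZ (X : set ((p + q).-tuple T)) : measurable X -> mu X = mu (X `\` Z).
  move=> mX; rewrite (measureDI mu mX mZ0) (@subset_measure0 _ _ _ mu (X `&` Z) Z) ?adde0//.
  exact: measurableI.
have inZ i j c : (i < j)%N -> (j < q.+1)%N -> excess c i = excess c j -> Z c.
  move=> ij jq e; rewrite /Z -(bigcup_mkord _ (fun i => \big[setU/set0]_(j < q.+1) tie i j)).
  exists i => /=; first exact: ltn_trans jq.
  rewrite -(bigcup_mkord _ (fun j => tie i j)); exists j => //=.
  by rewrite /tie ij.
have mAZ (r : 'I_q.+1) : measurable (argmin_excess r `\` Z : set ((p + q).-tuple T)).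
  by apply: measurableD => //; exact: (mA _ (ltn_ord r)).
rewrite muE// (muE _ mS) (notZ _ mS).
have -> : simplices `\` Z = \big[setU/set0]_(r < q.+1) (argmin_excess r `\` Z).
  rewrite -(bigcup_mkord _ (fun r => argmin_excess r `\` Z)).
  apply/seteqP; split => [c [sc Zc]|c [r _ [[sc _] Zc]]]; last by split.
  have [r _ rmin] := @arg_minP _ _ _ (ord0 : 'I_q.+1) xpredT (excess c) isT.
  exists r; first exact: ltn_ord.
  by split => //; split => // j jq; exact: (rmin (Ordinal jq)).
rewrite measure_bigsetU_ord//.
- rewrite (eq_bigr (fun=> mu dominated)) => [|r _]; last first.
    transitivity (mu (argmin_excess r)); first by apply: esym; apply: notZ; exact: (mA _ (ltn_ord r)).
    rewrite -muE; last exact: (mA _ (ltn_ord r)).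
    rewrite -(iter_rotate_dominated (ltn_ord r)).
    by have [_ ->] := volume_iter_rotate r mD; rewrite muE.
  by rewrite sumr_const card_ord mule_natl.
- apply/trivIsetP => i j _ _ ij; apply/seteqP; split => // c [[[_ hi] Zc] [[_ hj] _]].
  have e : excess c i = excess c j by apply/eqP; rewrite eq_le hi// hj.
  exfalso; apply: Zc; case: (ltngtP i j) => [lt_ij|lt_ji|eij].
  + exact: (inZ _ _ _ lt_ij (ltn_ord j) e).
  + exact: (inZ _ _ _ lt_ji (ltn_ord i) (esym e)).
  + by move/eqP: ij; case; exact/val_inj.
Qed.

End CycleLemma.

(** * Flows as functions on pairs of vertices *)

Section EdgeFlow.
Context {R : realType}.
Variable G : digraph.
Hypothesis uniqG : uniq G.

(** Extending a flow by 0 to all pairs turns sums over the edges at a vertex into sums over a range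
    of vertices. *)
Definition edge_flow (f : 'rV[R]_(size G)) (e : nat * nat) : R :=
  \sum_(o | tnth (in_tuple G) o == e) f 0 o.

Lemma edge_flow_tnth f o : edge_flow f (tnth (in_tuple G) o) = f 0 o.
Proof.
rewrite /edge_flow (bigD1 o)//= big1 ?addr0// => o' /andP[/eqP e /eqP[]].
by apply/val_inj/eqP; move/eqP: e; rewrite !(tnth_nth (0, 0)%N) nth_uniq.
Qed.

Lemma edge_flow_out f e : e \notin G -> edge_flow f e = 0.
Proof.
move=> eG; rewrite /edge_flow big1// => o /eqP oe.
by move: eG; rewrite -oe mem_tnth.
Qed.

Lemma edge_flow_row (Phi : nat * nat -> R) e : e \in G ->
  edge_flow (\row_o Phi (tnth (in_tuple G) o)) e = Phi e.
Proof. by move=> /(tnthP (in_tuple G)) [ed ->]; rewrite edge_flow_tnth mxE. Qed.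

Lemma edge_flow_ge0 (f : 'rV[R]_(size G)) :
  (forall o, 0 <= f 0 o) <-> (forall e, e \in G -> 0 <= edge_flow f e).
Proof.
split=> [f0 e /(tnthP (in_tuple G)) [ed ->]|f0 o]; first by rewrite edge_flow_tnth.
by rewrite -edge_flow_tnth f0// mem_tnth.
Qed.

Variable N : nat.
Hypothesis boundG : forall i j, (i, j) \in G -> (1 <= i < N)%N && (1 <= j < N)%N.

Let sum_select (j : nat) (x : R) : (1 <= j < N)%N ->
  \sum_(1 <= l < N) (if j == l then x else 0) = x.
Proof.
move=> jN; rewrite -big_mkcond /= (eq_bigl (fun l => l == j)) => [|l]; last exact: eq_sym.
by rewrite big_nat1_eq jN.
Qed.

Lemma sum_edge_src (f : 'rV[R]_(size G)) j :
  \sum_(o | edge_src o == j) f 0 o = \sum_(1 <= l < N) edge_flow f (j, l).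
Proof.
rewrite /edge_flow; under [RHS]eq_bigr do rewrite big_mkcond.
rewrite exchange_big /= big_mkcond; apply: eq_bigr => o _.
rewrite /edge_src; have := mem_tnth o (in_tuple G).
case: (tnth _ o) => a b /boundG /andP[_ bN] /=.
case: eqVneq => [->|aj].
  rewrite -[LHS](sum_select _ bN); apply: eq_bigr => l _.
  by rewrite xpair_eqE eqxx.
by rewrite big1// => l _; rewrite xpair_eqE (negPf aj).
Qed.

Lemma sum_edge_tgt (f : 'rV[R]_(size G)) j :
  \sum_(o | edge_tgt o == j) f 0 o = \sum_(1 <= l < N) edge_flow f (l, j).
Proof.
rewrite /edge_flow; under [RHS]eq_bigr do rewrite big_mkcond.
rewrite exchange_big /= big_mkcond; apply: eq_bigr => o _.
rewrite /edge_tgt; have := mem_tnth o (in_tuple G).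
case: (tnth _ o) => a b /boundG /andP[aN _] /=.
case: eqVneq => [->|aj].
  rewrite -[LHS](sum_select _ aN); apply: eq_bigr => l _.
  by rewrite xpair_eqE eqxx andbT.
by rewrite big1// => l _; rewrite xpair_eqE (negPf aj) andbF.
Qed.

End EdgeFlow.

(** * Edges and conservation equations of the caracol graph *)

Section CaracolGraph.

Lemma mem_caracol k n (i j : nat) : (k <= n)%N ->
  ((i, j) \in caracol k n) = caracol_edge k n (i, j).
Proof.
move=> kn; rewrite mem_filter; apply: andb_idr => h.
apply/allpairsPdep; exists i, j; move: h; rewrite !mem_iota /caracol_edge /= => h.
by split=> //; move: h; lia.
Qed.

Lemma caracol_uniq k n : uniq (caracol k n).
Proof.
apply: filter_uniq; apply: allpairs_uniq; rewrite ?iota_uniq//.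
by move=> [a b] [a' b'].
Qed.

Lemma caracol_bound k n (i j : nat) : (k <= n)%N -> (i, j) \in caracol k n ->
  (1 <= i < n.+2)%N && (1 <= j < n.+2)%N.
Proof. by move=> kn; rewrite mem_caracol// /caracol_edge /=; lia. Qed.

End CaracolGraph.

Lemma sum_nat_single (V : nmodType) a b x (F : nat -> V) : (a <= x < b)%N ->
    (forall l, (a <= l < b)%N -> l != x -> F l = 0) ->
  \sum_(a <= l < b) F l = F x.
Proof.
move=> xab F0; transitivity (\sum_(a <= l < b | l == x) F l); last first.
  by rewrite big_nat1_eq xab.
rewrite [RHS]big_mkcond; apply: eq_big_nat => l lab.
by case: eqVneq => // lx; exact: F0.
Qed.

Lemma sum_nat_eq0 (V : nmodType) a b (F : nat -> V) :
  (forall l, (a <= l < b)%N -> F l = 0) -> \sum_(a <= l < b) F l = 0.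
Proof. by move=> F0; rewrite big_nat big1. Qed.

Lemma sum_nat_blocks (V : nmodType) m k (F : nat -> V) :
  \sum_(0 <= x < m * k) F x = \sum_(0 <= j < m) \sum_(0 <= i < k) F (j * k + i)%N.
Proof.
elim: m => [|m IH]; first by rewrite !big_geq.
rewrite big_nat_recr//= -IH (big_cat_nat _ (n := (m * k)%N))//=; last by rewrite mulSn leq_addl.
congr (_ + _); rewrite -[X in \sum_(X <= _ < _) _]add0n big_addn mulSn addnK.
by apply: eq_bigr => i _; rewrite addnC.
Qed.

Section CaracolFlow.
Context {R : realType}.
Variables k q : nat.
Hypothesis k_gt0 : (0 < k)%N.

Local Notation n := (k + q.+1)%N.
Local Notation G := (caracol k n).

Let kn : (k <= n)%N. Proof. exact: leq_addr. Qed.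

(* The flow along the path [1 -> 2 -> ... -> k], with the convention that it
   starts with the unit netflow and leaves nothing at [k]. *)
Definition spine (F : nat * nat -> R) i :=
  if i == 0%N then 1 else if (i < k)%N then F (i, i.+1) else 0.

(* The flow from [k + j] to [k + j + 1]; the edge [n -> n + 1] is counted in
   [F (n, n.+1)] and not here. *)
Definition tail (F : nat * nat -> R) j :=
  if (0 < j < q.+1)%N then F (k + j, (k + j).+1)%N else 0.

(** The boundary conventions of [spine] and [tail] give the first and last vertices of each path the
    same equation as the others. *)
Definition conserved (F : nat * nat -> R) :=
  (forall i, (i < k)%N ->
     spine F i.+1 + \sum_(0 <= j < q.+1) F (i.+1, k + j.+1)%N = spine F i) /\
  (forall j, (j < q.+1)%N ->
     tail F j.+1 + F (k + j.+1, n.+1)%N =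
     \sum_(0 <= i < k) F (i.+1, k + j.+1)%N + tail F j).

Lemma flow_polytope_caracol (f : 'rV[R]_(size G)) :
  flow_polytope n G (unit_netflow R n) f <->
  (forall e, 0 <= f 0 e) /\ conserved (edge_flow f).
Proof.
set F := edge_flow f.
have Fout i j : ~~ caracol_edge k n (i, j) -> F (i, j) = 0.
  by move=> h; apply: edge_flow_out; rewrite mem_caracol.
have shift a b (g : nat -> R) :
    \sum_(a.+1 <= l < (a + b).+1) g l = \sum_(0 <= l < b) g (a + l.+1)%N.
  rewrite -[LHS]/(\sum_(0 + a.+1 <= l < (a + b).+1) g l) big_addn subSS addKn.
  by apply: eq_bigr => i _; rewrite addnC addSnnS.
have outs i : (i < k)%N -> \sum_(1 <= l < n.+2) F (i.+1, l) =
    spine F i.+1 + \sum_(0 <= j < q.+1) F (i.+1, k + j.+1)%N.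
  move=> ik; rewrite (big_cat_nat _ (n := k.+1)) ?ltnS ?(leqW kn)//=; congr (_ + _).
    rewrite /spine /=; case: ifPn => ik1.
      apply: (@sum_nat_single _ _ _ i.+2); first lia.
      by move=> l lk li; apply: Fout; rewrite /caracol_edge /=; lia.
    by apply: sum_nat_eq0 => l lk; apply: Fout; rewrite /caracol_edge /=; lia.
  rewrite big_nat_recr /=; last lia.
  rewrite [F (_, n.+1)]Fout ?addr0 ?shift//.
  by rewrite /caracol_edge /=; lia.
have ins i : (i < k)%N -> \sum_(1 <= l < n.+2) F (l, i.+1) = if i == 0%N then 0 else spine F i.
  move=> ik; rewrite /spine; case: eqVneq => [->|i0].
    by apply: sum_nat_eq0 => l lk; apply: Fout; rewrite /caracol_edge /=; lia.
  rewrite ik; apply: sum_nat_single; first lia.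
  by move=> l lk li; apply: Fout; rewrite /caracol_edge /=; lia.
have outt j : (j < q.+1)%N -> \sum_(1 <= l < n.+2) F (k + j.+1, l)%N =
    tail F j.+1 + F (k + j.+1, n.+1)%N.
  move=> jq; rewrite big_nat_recr /=; last lia.
  congr (_ + _); rewrite /tail /=; case: ifPn => jq1.
    apply: (@sum_nat_single _ _ _ (k + j.+1).+1); first lia.
    by move=> l lk li; apply: Fout; rewrite /caracol_edge /=; lia.
  by apply: sum_nat_eq0 => l lk; apply: Fout; rewrite /caracol_edge /=; lia.
have int_ j : (j < q.+1)%N -> \sum_(1 <= l < n.+2) F (l, k + j.+1)%N =
    \sum_(0 <= i < k) F (i.+1, k + j.+1)%N + tail F j.
  move=> jq; rewrite (big_cat_nat _ (n := k.+1)) ?ltnS ?(leqW kn)//=; congr (_ + _).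
    by rewrite big_add1.
  rewrite /tail; case: ifPn => j0.
    rewrite -(addnS k j); apply: (@sum_nat_single _ _ _ (k + j)%N); first lia.
    by move=> l lk li; apply: Fout; rewrite /caracol_edge /=; lia.
  by apply: sum_nat_eq0 => l lk; apply: Fout; rewrite /caracol_edge /=; lia.
have cons_at j : \sum_(e | edge_src e == j) f 0 e - \sum_(e | edge_tgt e == j) f 0 e =
    \sum_(1 <= l < n.+2) F (j, l) - \sum_(1 <= l < n.+2) F (l, j).
  by rewrite (sum_edge_src (N := n.+2)) ?(sum_edge_tgt (N := n.+2))// => a b; exact: caracol_bound.
rewrite /flow_polytope /=; split=> -[f0 h]; split=> //.
  split=> [i ik|j jq].
    have /h : (1 <= i.+1 <= n)%N by lia.
    rewrite cons_at outs// ins// /unit_netflow eqSS.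
    case: eqVneq => [->|i0]; first by rewrite subr0.
    by rewrite ifF; [move/subr0_eq|lia].
  have /h : (1 <= k + j.+1 <= n)%N by lia.
  rewrite cons_at outt// int_// /unit_netflow ifF; last lia.
  by rewrite ifF; [move/subr0_eq|lia].
move=> j jn; rewrite cons_at; have [jk|jk] := leqP j k.
  have -> : j = j.-1.+1 by lia.
  have ik : (j.-1 < k)%N by lia.
  rewrite outs// ins// (proj1 h)// /unit_netflow eqSS.
  case: eqVneq => [->|i0]; first by rewrite subr0.
  by rewrite ifF ?subrr//; lia.
have -> : j = (k + (j - k).-1.+1)%N by lia.
have jq : ((j - k).-1 < q.+1)%N by lia.
rewrite outt// int_// (proj2 h)// subrr /unit_netflow ifF; last lia.
by rewrite ifF//; lia.
Qed.

End CaracolFlow.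

Section CaracolEdges.
Context {R : realType}.
Variables k q : nat.

Local Notation n := (k + q.+1)%N.
Local Notation G := (caracol k n).
Implicit Types F : nat * nat -> R.

Let kn : (k <= n)%N. Proof. exact: leq_addr. Qed.

(** Four disjoint families: k -> k + 1 is counted among the edges from {1, ..., k} to {k + 1, ...,
    n}, and n -> n + 1 among those into the sink, so both paths stop one edge early. *)
Lemma caracol_ind (Q : nat * nat -> Prop) :
    (forall i j, (i < k)%N -> (j < q.+1)%N -> Q (i.+1, k + j.+1)%N) ->
    (forall i, (0 < i < k)%N -> Q (i, i.+1)) ->
    (forall j, (j < q.+1)%N -> Q (k + j.+1, n.+1)%N) ->
    (forall j, (0 < j < q.+1)%N -> Q (k + j, (k + j).+1)%N) ->
  forall e, e \in G -> Q e.
Proof.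
move=> Q1 Q2 Q3 Q4 [i j]; rewrite mem_caracol// /caracol_edge /=.
have [ik|ik] := leqP i k; have [jk|jk] := leqP j k => h.
- have -> : j = i.+1 by lia.
  by apply: Q2; lia.
- have [-> ->] : i = i.-1.+1 /\ j = (k + (j - k).-1.+1)%N by lia.
  by apply: Q1; lia.
- lia.
- have [->|jn] := eqVneq j n.+1.
    have -> : i = (k + (i - k).-1.+1)%N by lia.
    by apply: Q3; lia.
  have -> : j = i.+1 by lia.
  have -> : i = (k + (i - k))%N by lia.
  by apply: Q4; lia.
Qed.

Lemma caracol_fan i j : (i < k)%N -> (j < q.+1)%N -> (i.+1, k + j.+1)%N \in G.
Proof. by move=> *; rewrite mem_caracol// /caracol_edge /=; lia. Qed.

Lemma caracol_spine i : (0 < i < k)%N -> (i, i.+1) \in G.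
Proof. by move=> *; rewrite mem_caracol// /caracol_edge /=; lia. Qed.

Lemma caracol_sink j : (j < q.+1)%N -> (k + j.+1, n.+1)%N \in G.
Proof. by move=> *; rewrite mem_caracol// /caracol_edge /=; lia. Qed.

Lemma caracol_tail j : (0 < j < q.+1)%N -> (k + j, (k + j).+1)%N \in G.
Proof. by move=> *; rewrite mem_caracol// /caracol_edge /=; lia. Qed.

(** Lets [caracol_flow], whose values off the graph are arbitrary, stand in for an actual flow. *)
Lemma eq_conserved F F' : {in G, F =1 F'} -> conserved k q F -> conserved k q F'.
Proof.
move=> FF.
have sE i : spine k F i = spine k F' i.
  rewrite /spine; case: eqVneq => // i0; case: ifPn => // ik.
  by apply: FF; apply: caracol_spine; rewrite lt0n i0.
have tE j : tail k q F j = tail k q F' j.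
  by rewrite /tail; case: ifPn => // jq; apply: FF; exact: caracol_tail.
move=> [h1 h2]; split=> [i ik|j jq].
  rewrite -!sE -(h1 i ik); congr (_ + _); apply: eq_big_nat => j /andP[_ jq].
  by apply/esym/FF; exact: caracol_fan.
rewrite -!tE -FF ?caracol_sink// h2//; congr (_ + _).
by apply: eq_big_nat => i /andP[_ ik]; apply: FF; exact: caracol_fan.
Qed.

End CaracolEdges.

(** * Coordinates on the space of conserved flows *)

Section CaracolChart.
Context {R : realType}.
Variables k p q : nat.

Local Notation n := (k + q.+1)%N.
Local Notation G := (caracol k n).
Local Notation tup := ((p + q).-tuple R).
Implicit Types (c : tup) (F : nat * nat -> R).

Definition fan_sum c i := \sum_(0 <= j < q.+1) ycoord c (j * k + i).

(** The solution of the conservation equations in terms of y and w. On the edge i -> i + 1 of the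
    first path remains the unit netflow minus what vertices 1, ..., i have sent to {k + 1, ...,
    n}. *)
Definition caracol_flow c (e : nat * nat) : R :=
  if (e.1 <= k)%N then
    if (k < e.2)%N then ycoord c ((e.2 - k.+1) * k + e.1.-1)
    else 1 - \sum_(0 <= i < e.1) fan_sum c i
  else if e.2 == n.+1 then wcoord c (e.1 - k.+1) else excess k c (e.1 - k).

Lemma caracol_flow_fan c i j : (i < k)%N -> (j < q.+1)%N ->
  caracol_flow c (i.+1, k + j.+1)%N = ycoord c (j * k + i).
Proof.
move=> ik jq; rewrite /caracol_flow /= ik ifT; last lia.
by have -> : (k + j.+1 - k.+1)%N = j by lia.
Qed.

Lemma caracol_flow_spine c i : (0 < i < k)%N ->
  caracol_flow c (i, i.+1) = 1 - \sum_(0 <= l < i) fan_sum c l.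
Proof. by move=> ik; rewrite /caracol_flow /= ifT ?ifF//; lia. Qed.

Lemma caracol_flow_sink c j : (j < q.+1)%N ->
  caracol_flow c (k + j.+1, n.+1)%N = wcoord c j.
Proof.
move=> jq; rewrite /caracol_flow /= ifF; last lia.
by rewrite eqxx; have -> : (k + j.+1 - k.+1)%N = j by lia.
Qed.

Lemma caracol_flow_tail c j : (0 < j < q.+1)%N ->
  caracol_flow c (k + j, (k + j).+1)%N = excess k c j.
Proof.
move=> jq; rewrite /caracol_flow /= ifF; last lia.
by rewrite ifF ?addKn//; lia.
Qed.

Lemma excessS c j : excess k c j.+1 =
  excess k c j + \sum_(0 <= i < k) ycoord c (j * k + i) - wcoord c j.
Proof.
rewrite /excess !sum_nat_blocks !big_nat_recr//=; ring.
Qed.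

Hypothesis kq : (q.+1 * k)%N = p.+1.

Let k_gt0 : (0 < k)%N.
Proof. by case: (posnP k) kq => [->|//]; rewrite muln0. Qed.

Lemma sum_fan_sum c : \sum_(0 <= i < k) fan_sum c i = 1.
Proof. by rewrite exchange_big /= -sum_nat_blocks kq sum_ycoord. Qed.

Lemma spine_caracol_flow c i : (i <= k)%N ->
  spine k (caracol_flow c) i = 1 - \sum_(0 <= l < i) fan_sum c l.
Proof.
move=> ik; rewrite /spine; case: eqVneq => [->|i0]; first by rewrite big_geq// subr0.
case: ifPn => ik1; first by rewrite caracol_flow_spine// lt0n i0.
have -> : i = k by lia.
by rewrite sum_fan_sum subrr.
Qed.

Lemma tail_caracol_flow c j : (j <= q.+1)%N -> tail k q (caracol_flow c) j = excess k c j.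
Proof.
move=> jq; rewrite /tail; case: ifPn => h; first exact: caracol_flow_tail.
have [->|->] : j = 0%N \/ j = q.+1 by lia.
  by rewrite excess0.
by rewrite excess_last.
Qed.

Lemma conserved_caracol_flow c : conserved k q (caracol_flow c).
Proof.
split=> [i ik|j jq].
  rewrite !spine_caracol_flow//; last exact: ltnW.
  have -> : \sum_(0 <= j < q.+1) caracol_flow c (i.+1, k + j.+1)%N = fan_sum c i.
    by apply: eq_big_nat => j /andP[_ jq]; rewrite caracol_flow_fan.
  by rewrite big_nat_recr//=; ring.
rewrite !tail_caracol_flow//; last exact: ltnW.
have -> : \sum_(0 <= i < k) caracol_flow c (i.+1, k + j.+1)%N =
    \sum_(0 <= i < k) ycoord c (j * k + i).
  by apply: eq_big_nat => i /andP[_ ik]; rewrite caracol_flow_fan.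
by rewrite caracol_flow_sink// excessS; ring.
Qed.

(** The edge whose flow is the [i]-th free coordinate; reading these flows inverts the
    parametrization, also over the integers. *)
Definition free_edge i : nat * nat :=
  if (i < p)%N then ((i %% k).+1, k + (i %/ k).+1)%N else (k + (i - p).+1, n.+1)%N.

Lemma free_edge_in i : (i < p + q)%N -> free_edge i \in G.
Proof.
move=> ipq; rewrite /free_edge; case: ifPn => ip.
  by apply: caracol_fan; [rewrite ltn_pmod|rewrite ltn_divLR//; lia].
by apply: caracol_sink; lia.
Qed.

Lemma caracol_flow_free c i : (i < p + q)%N -> caracol_flow c (free_edge i) = c`_i.
Proof.
move=> ipq; rewrite /free_edge; case: ifPn => ip.
  rewrite caracol_flow_fan ?ltn_pmod//; last by rewrite ltn_divLR//; lia.
  by rewrite -divn_eq /ycoord ip.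
rewrite caracol_flow_sink; last lia.
by rewrite /wcoord ifT ?subnKC//; lia.
Qed.

(** The free coordinates are read off [F], and conservation, summed along the two paths, determines
    the rest. The totals of y and w are 1 because [spine] vanishes at [k] and [tail] at [q.+1], so
    the dependent coordinates agree with [F] too. *)
Lemma conserved_caracol_flowP F : conserved k q F ->
  exists c, {in G, caracol_flow c =1 F}.
Proof.
move=> [hs ht].
pose c : tup := [tuple F (free_edge i) | i < p + q].
have nth_c i : (i < p + q)%N -> c`_i = F (free_edge i).
  by move=> ipq; rewrite -[i in LHS]/(val (Ordinal ipq)) nth_mktuple.
pose y i := F ((i %% k).+1, k + (i %/ k).+1)%N.
have yE i j : (i < k)%N -> y (j * k + i)%N = F (i.+1, k + j.+1)%N.
  by move=> ik; rewrite /y modnMDl modn_small// divnMDl// divn_small// addn0.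
have spineE i : (i <= k)%N -> spine k F i =
    1 - \sum_(0 <= l < i) \sum_(0 <= j < q.+1) y (j * k + l)%N.
  elim: i => [|i IH] ik; first by rewrite big_geq// subr0.
  rewrite big_nat_recr//= opprD addrA -IH ?(ltnW ik)// -(hs i ik).
  rewrite [X in _ = _ - X](eq_big_nat _ _ (F2 := fun j => F (i.+1, k + j.+1)%N)) ?addrK//.
  by move=> j _; exact: yE.
have sum_y : \sum_(0 <= i < p.+1) y i = 1.
  have := spineE k (leqnn k); rewrite /spine ltnn gtn_eqF// exchange_big /=.
  by rewrite -sum_nat_blocks kq => /esym/subr0_eq.
have ycE i : (i < p.+1)%N -> ycoord c i = y i.
  have small l : (l < p)%N -> c`_l = y l.
    by move=> lp; rewrite nth_c; [rewrite /free_edge lp|lia].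
  rewrite ltnS leq_eqVlt => /predU1P[->|ip]; last by rewrite /ycoord ip small.
  rewrite /ycoord ltnn -sum_y big_nat_recr//=.
  rewrite (eq_big_nat _ _ (F1 := fun j => c`_j) (F2 := y)); first by rewrite addrAC subrr add0r.
  by move=> j /andP[_ jp]; exact: small.
pose w j := F (k + j.+1, n.+1)%N.
have tailE j : (j <= q.+1)%N -> tail k q F j =
    \sum_(0 <= i < j * k) y i - \sum_(0 <= i < j) w i.
  elim: j => [|j IH] jq; first by rewrite /tail /= !big_geq// subr0.
  rewrite sum_nat_blocks !big_nat_recr//= -sum_nat_blocks.
  have := ht j jq; rewrite IH ?(ltnW jq)// => /(canRL (addrK _)) ->.
  rewrite (eq_big_nat _ _ (F1 := fun i => y (j * k + i)%N) (F2 := fun i => F (i.+1, k + j.+1)%N)).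
    by rewrite /w; ring.
  by move=> i /andP[_ ik]; exact: yE.
have sum_w : \sum_(0 <= i < q.+1) w i = 1.
  have := tailE q.+1 (leqnn _); rewrite /tail ltnn andbF kq sum_y.
  by move=> /esym/subr0_eq.
have wcE i : (i < q.+1)%N -> wcoord c i = w i.
  have small l : (l < q)%N -> c`_(p + l) = w l.
    move=> lq; rewrite nth_c ?ltn_add2l//.
    by rewrite /free_edge ltnNge leq_addr/= addKn.
  rewrite ltnS leq_eqVlt => /predU1P[->|iq]; last by rewrite /wcoord iq small.
  rewrite /wcoord ltnn -sum_w big_nat_recr//=.
  rewrite (eq_big_nat _ _ (F1 := fun j => c`_(p + j)) (F2 := w)); first by rewrite addrAC subrr add0r.
  by move=> j /andP[_ jp]; exact: small.
have fan_bound i j : (i < k)%N -> (j < q.+1)%N -> (j * k + i < p.+1)%N by rewrite -kq; nia.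
exists c; apply: caracol_ind => [i j ik jq|i ik|j jq|j jq].
- by rewrite caracol_flow_fan// ycE ?fan_bound// yE.
- rewrite caracol_flow_spine//.
  have := spineE i; rewrite /spine gtn_eqF ?(andP ik).2; last by case/andP: ik.
  move=> -> //; last lia.
  congr (_ - _); apply: eq_big_nat => l /andP[_ li]; apply: eq_big_nat => j /andP[_ jq].
  by rewrite ycE// fan_bound//; lia.
- by rewrite caracol_flow_sink// wcE.
- rewrite caracol_flow_tail//.
  have := tailE j; rewrite /tail jq => ->; last lia.
  congr (_ - _); apply: eq_big_nat => i /andP[_ ij].
    by rewrite ycE// -kq; nia.
  by rewrite wcE//; lia.
Qed.

End CaracolChart.

(** * The volume of the caracol flow polytope *)

Section CaracolVolume.
Context {R : realType}.
Local Notation T := (measurableTypeR R).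
Local Notation vol := (@lebesgue_volume R _).
Variables k p q : nat.
Hypothesis kq : (q.+1 * k)%N = p.+1.

Local Notation n := (k + q.+1)%N.
Local Notation G := (caracol k n).
Local Notation tup := ((p + q).-tuple R).
Local Notation P := (flow_polytope n G (unit_netflow R n)).
Implicit Types c : tup.

Let k_gt0 : (0 < k)%N.
Proof. by case: (posnP k) kq => [->|//]; rewrite muln0. Qed.

Lemma int_affine_caracol_flow e : int_affine (fun c => caracol_flow k c e).
Proof.
rewrite /caracol_flow; case: (e.1 <= k)%N; last first.
  by case: (e.2 == n.+1); [exact: int_affine_wcoord|exact: int_affine_excess].
case: (k < e.2)%N; first exact: int_affine_ycoord.
apply: int_affineB; first exact: int_affine_cst.
apply: int_affine_sum => i _ _; apply: int_affine_sum => j _ _.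
exact: int_affine_ycoord.
Qed.

Let flow_row c : 'rV[R]_(size G) := \row_o caracol_flow k c (tnth (in_tuple G) o).

Let edge_flow_row_in c : {in G, edge_flow (flow_row c) =1 caracol_flow k c}.
Proof. by move=> e; exact: (edge_flow_row (caracol_uniq k n)). Qed.

Lemma caracol_flow_ge0 c :
  (forall o, 0 <= flow_row c 0 o) <-> dominated k c.
Proof.
rewrite (edge_flow_ge0 (caracol_uniq _ _)); split=> [h|[[y0 w0] x0]].
  have {}h e : e \in G -> 0 <= caracol_flow k c e.
    by move=> eG; rewrite -edge_flow_row_in// h.
  split; first split.
  - move=> i ip; have ik : (i %% k < k)%N by rewrite ltn_pmod.
    have iq : (i %/ k < q.+1)%N by rewrite ltn_divLR// kq.
    by have := h _ (caracol_fan ik iq); rewrite (caracol_flow_fan c ik iq) -divn_eq.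
  - by move=> j jq; have := h _ (caracol_sink k jq); rewrite caracol_flow_sink.
  - move=> j jq; have [->|j0] := posnP j; first by rewrite excess0.
    have jb : (0 < j < q.+1)%N by rewrite j0.
    by have := h _ (caracol_tail k jb); rewrite caracol_flow_tail.
have fan_ge0 i : (i < k)%N -> 0 <= fan_sum k c i.
  move=> ik; rewrite /fan_sum big_nat sumr_ge0// => j /andP[_ jq].
  by apply: y0; rewrite -kq; nia.
move=> e eG; rewrite edge_flow_row_in//; move: e eG.
apply: caracol_ind => [i j ik jq|i ik|j jq|j jq].
- by rewrite caracol_flow_fan// y0// -kq; nia.
(* Writing 1 as the total of y exhibits this flow as the sum of the remaining [fan_sum] terms, hence
   nonnegative. *)
- rewrite caracol_flow_spine// -(sum_fan_sum kq c) (big_cat_nat _ (n := i))//=; last lia.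
  by rewrite addrAC subrr add0r big_nat sumr_ge0// => l /andP[_ lk]; exact: fan_ge0.
- by rewrite caracol_flow_sink// w0.
- by rewrite caracol_flow_tail// x0//; lia.
Qed.

Lemma caracol_interior : exists c, forall o, 0 < flow_row c 0 o.
Proof.
(* With y and w both uniform every excess would be 0. Halving the free entries of [w], and leaving
   the remainder to the last one, makes the excess at [j] equal to [j / (2 (q + 1))], positive for
   the edges of the second path. *)
pose a : R := p.+1%:R^-1; pose b : R := q.+1%:R^-1 / 2.
have p0 : 0 < p.+1%:R :> R by rewrite ltr0n.
have q0 : 0 < q.+1%:R :> R by rewrite ltr0n.
have a0 : 0 < a by rewrite invr_gt0.
have b0 : 0 < b by rewrite divr_gt0// invr_gt0.
pose c : tup := [tuple if (i < p)%N then a else b | i < p + q].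
have nth_c i : (i < p + q)%N -> c`_i = if (i < p)%N then a else b.
  by move=> ipq; rewrite -[i in LHS]/(val (Ordinal ipq)) nth_mktuple.
have yE i : ycoord c i = a.
  rewrite /ycoord; case: ifPn => ip; first by rewrite nth_c ?ip//; lia.
  rewrite (eq_big_nat _ _ (F2 := fun=> a)).
    rewrite sumr_const_nat subn0 -[X in X - _](mulVf (lt0r_neq0 p0)) -/a.
    by rewrite -(mulr_natr a) -[p.+1]addn1 natrD; ring.
  by move=> j /andP[_ jp]; rewrite nth_c ?jp//; lia.
have wE i : (i < q)%N -> wcoord c i = b.
  by move=> iq; rewrite /wcoord iq nth_c ?ltn_add2l// ltnNge leq_addr.
have w0 i : 0 < wcoord c i.
  have [iq|iq] := ltnP i q; first by rewrite wE.
  rewrite /wcoord ltnNge iq /= (eq_big_nat _ _ (F2 := fun=> b)); last first.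
    by move=> j /andP[_ jq]; rewrite nth_c ?ltn_add2l// ltnNge leq_addr.
  rewrite sumr_const_nat subn0 subr_gt0 -mulr_natr /b -mulrA ltr_pdivrMl//.
  rewrite -[q.+1]addn1 natrD.
  have : 0 <= q%:R :> R by rewrite ler0n.
  lra.
have fanE i : fan_sum k c i = k%:R^-1.
  rewrite /fan_sum (eq_bigr (fun=> a)) => [|j _]; last exact: yE.
  by rewrite sumr_const_nat subn0 -(mulr_natr a) /a -kq natrM invfM mulrAC mulVf ?mul1r//.
have k0 : 0 < k%:R :> R by rewrite ltr0n.
exists c => o; rewrite mxE.
have : tnth (in_tuple G) o \in G by exact: mem_tnth.
move: (tnth _ o); apply: caracol_ind => [i j ik jq|i ik|j jq|j jq].
- by rewrite caracol_flow_fan// yE.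
- rewrite caracol_flow_spine// (eq_bigr (fun=> k%:R^-1)) => [|l _]; last exact: fanE.
  rewrite sumr_const_nat subn0 -(mulr_natr k%:R^-1) subr_gt0 mulrC ltr_pdivrMr// mul1r ltr_nat.
  by case/andP: ik.
- by rewrite caracol_flow_sink.
- rewrite caracol_flow_tail// /excess (eq_bigr (fun=> a)) => [|i _]; last exact: yE.
  rewrite [X in _ - X](eq_big_nat _ _ (F2 := fun=> b)); last first.
    by move=> i /andP[_ ij]; apply: wE; lia.
  rewrite !sumr_const_nat !subn0 -(mulr_natr a) -(mulr_natr b) /a /b -kq !natrM invfM.
  have -> : q.+1%:R^-1 / k%:R * (j%:R * k%:R) = q.+1%:R^-1 * j%:R :> R.
    by field; rewrite !gt_eqF.
  rewrite mulrAC -[X in X - _]mulr1 -mulrBr mulr_gt0//; last lra.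
  by rewrite mulr_gt0 ?invr_gt0// ltr0n; case/andP: jq.
Qed.

Lemma normalized_volume_caracol :
  normalized_volume P = ((p + q)`!%:R * (p`!%:R * q.+1`!%:R)^-1)%:E.
Proof.
have uG := caracol_uniq k n.
have [B [p0 BE]] := int_affine_chart
  (fun o => int_affine_caracol_flow (tnth (in_tuple G) o)).
rewrite -/flow_row in BE.
(* [D] reads the flows on the free edges. These are the chart coordinates themselves, so [p0] is
   mapped to 0 and [D] is an integral right inverse of [B]. *)
pose D : 'M[int]_(size G, p + q) :=
  \matrix_(o, i) (tnth (in_tuple G) o == free_edge k p q i)%:R.
have fD f : f *m map_mx intr D = \row_i edge_flow f (free_edge k p q i) :> 'rV[R]_(p + q).
  apply/rowP => i; rewrite !mxE /edge_flow [RHS]big_mkcond; apply: eq_bigr => o _.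
  by rewrite !mxE; case: eqP => _; rewrite ?mulr1 ?mulr0.
have chartD c : lattice_chart p0 B c *m map_mx intr D = row_of_tuple c.
  rewrite -BE fD; apply/rowP => i; rewrite !mxE.
  rewrite edge_flow_row_in ?(free_edge_in kq)//.
  by rewrite (caracol_flow_free kq)// (tnth_nth 0).
have BD : B *m D = 1%:M.
  apply: (@map_intr_inj R); rewrite map_mxM /= map_mx1; apply/row_matrixP => i.
  have p0D : p0 *m map_mx intr D = 0.
    have := chartD (tuple_of_row 0).
    by rewrite lattice_chartE tuple_of_rowK mul0mx addr0.
  rewrite rowE row1; have := chartD (tuple_of_row (delta_mx 0 i)).
  by rewrite lattice_chartE tuple_of_rowK mulmxDl p0D add0r mulmxA.
have PE f : P f <-> (forall e, 0 <= f 0 e) /\ (f - p0 <= map_mx intr B)%MS.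
  rewrite flow_polytope_caracol//; split=> -[f0 h]; split=> //.
    have [c cE] := conserved_caracol_flowP kq h.
    have -> : f = lattice_chart p0 B c.
      by rewrite -BE; apply/rowP => o; rewrite mxE cE ?mem_tnth// edge_flow_tnth.
    by rewrite lattice_chartE addrAC subrr add0r submxMl.
  case/submxP: h => u /eqP; rewrite subr_eq addrC => /eqP fE.
  have {}fE : f = flow_row (tuple_of_row u).
    by rewrite [RHS]BE lattice_chartE tuple_of_rowK.
  apply: (@eq_conserved _ k q (caracol_flow k (tuple_of_row u))).
    by move=> e eG; rewrite fE edge_flow_row_in.
  exact: conserved_caracol_flow.
have [c0 c0gt] := caracol_interior.
have [basB hullp0] : lattice_basis P B /\ affine_hull P p0.
  apply: (lattice_basis_polyhedron (c0 := flow_row c0) BD PE) => //.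
  by rewrite [flow_row _]BE lattice_chartE addrAC subrr add0r submxMl.
have chartP : lattice_chart p0 B @^-1` P = dominated k (q := q).
  apply/seteqP; split => c /=; rewrite -BE.
    by move=> /PE[+ _] => /caracol_flow_ge0.
  move=> cd; apply/PE; split; first exact/caracol_flow_ge0.
  by rewrite BE lattice_chartE addrAC subrr add0r submxMl.
rewrite (normalized_volume_chart basB hullp0) chartP; last exact: measurable_dominated.
have := volume_dominated kq (R := R); rewrite volume_simplices => volE.
have -> : vol (@dominated R k p q) = ((p`!%:R * q.+1`!%:R)^-1)%:E.
  move/(congr1 (fun z => (q.+1%:R^-1)%:E * z)%E): volE.
  rewrite muleA -EFinM mulVf ?pnatr_eq0// mul1e -EFinM => ->.
  by congr EFin; rewrite factS natrM !invfM; ring.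
by rewrite -EFinM.
Qed.

End CaracolVolume.

Theorem theorem2p17 (R : realType) (k n : nat) (hk : (1 <= k)%N) (hn : (k < n)%N) :
  normalized_volume (flow_polytope n (caracol k n) (unit_netflow R n))
  = (rational_catalan R (n - k)%N (k * (n - k) - 1)%N)%:E.
Proof.
have [q nE] : exists q, n = (k + q.+1)%N by exists (n - k).-1; lia.
pose p := (q.+1 * k).-1.
have kq : (q.+1 * k)%N = p.+1 by rewrite prednK// muln_gt0.
(* The Catalan parameters become [q.+1] and [p], with sum one more than the dimension [p + q]; what
   is left is an identity of factorials. *)
rewrite {}nE addKn mulnC kq subn1 /= (normalized_volume_caracol kq); congr EFin.
rewrite /rational_catalan addSn addnC.
have E : 'C((q + p).+1, q.+1)%:R * (q.+1`!%:R * p`!%:R) = (q + p).+1%:R * (q + p)`!%:R :> R.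
  rewrite -!natrM -factS -addSn; congr _%:R.
  by rewrite -[RHS](bin_fact (leq_addr p q.+1)) addKn.
have fact_neq0 m : m`!%:R != 0 :> R by rewrite pnatr_eq0 -lt0n fact_gt0.
have s0 : (q + p).+1%:R != 0 :> R by rewrite pnatr_eq0.
by apply: (mulfI s0); rewrite mulrA -E mulVKf// [p`!%:R * _]mulrC mulfK//.
Qed.
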